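(* Fix $a\in\mathbb R$, $\lambda>0$ and $X_0\in W^{1,1}(\mathbb S,\mathbb R^2)$ with $\mathcal L(X_0)>0$. Let $X\in C^1([0,T_a),W^{1,1}(\mathbb S,\mathbb R^2))$ be the maximal positive-length solution of $\partial_tX=F_{\lambda,a}(X)$ and $Y\in C^1([0,\infty),W^{1,1}(\mathbb S,\mathbb R^2))$ the maximal solution of $\partial_tY=F_{\lambda,2}(Y)$, with $X(\cdot,0)=Y(\cdot,0)=X_0$. Then $X$ and $Y$ differ by a time reparametrisation: $$Y(\cdot,t)=X(\cdot,\theta(t))\qquad\text{for all }t\ge0,$$ where $\theta:[0,\infty)\to[0,T_a)$ is defined by $\theta(t)=\int_0^t\mathcal L(Y(\cdot,\tau))^{2-a}\,d\tau$.
   Context: $\mathbb S=[0,1]/\{0\sim 1\}$ is the circle. $W^{1,1}(\mathbb S,\mathbb R^2)$ is the usual Sobolev space, with elements identified with their absolutely continuous representatives. Length: $\mathcal L(\gamma)=\int_0^1|\gamma'(u)|\,du$. For $\lambda>0$, $\mathcal G^\lambda:\mathbb S\to\mathbb R$ is the 1-periodic extension of $$\mathcal G^\lambda(x)=-\frac{\cosh\left(\frac{|x|-1/2}{\lambda}\right)}{2\lambda\sinh\left(\frac1{2\lambda}\right)},\qquad x\in[0,1].$$ For $\mathcal L(\gamma)>0$ set $\rho_\gamma(u)=\frac1{\mathcal L(\gamma)}\int_0^u|\gamma'(\tau)|\,d\tau$ and $$(\gamma*_\gamma\mathcal G^\lambda)(u)=\int_0^1\gamma(v)\,\mathcal G^\lambda(\rho_\gamma(v)-\rho_\gamma(u))\,\frac{|\gamma'(v)|}{\mathcal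 L(\gamma)}\,dv .$$ Define, for $b\in\mathbb R$, $F_{\lambda,b}(\gamma)=-\frac{\mathcal L(\gamma)^{b-2}}{\lambda^2}\left(\gamma+\gamma*_\gamma\mathcal G^\lambda\right)$ if $\mathcal L(\gamma)\ne0$ and $F_{\lambda,b}(\gamma)=0$ if $\mathcal L(\gamma)=0$. Equations are understood as ODEs in $W^{1,1}(\mathbb S,\mathbb R^2)$, with $X(u,t)=X(t)(u)$. A solution is positive-length if $\mathcal L(X(\cdot,t))>0$ for all $t$ in its interval of definition; $T_a\in(0,\infty]$ is the maximal (forward) time of existence as a positive-length solution. For every initial datum in $W^{1,1}(\mathbb S,\mathbb R^2)$ the equation with $b=2$ has a unique solution defined on all of $[0,\infty)$. *)

(* Defs.v *)
From HB Require Import structures.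
From mathcomp Require Import all_boot all_order all_algebra.
From mathcomp Require Import all_classical all_reals all_analysis.
From mathcomp Require Import measurable_realfun ring lra.

Set Implicit Arguments.
Unset Strict Implicit.
Unset Printing Implicit Defensive.

Import Order.TTheory GRing.Theory Num.Theory.
Import numFieldNormedType.Exports.

Local Open Scope classical_set_scope.
Local Open Scope ring_scope.

Section euclidean_plane.
Context {R : realType}.
Implicit Types v w : 'rV[R]_2.

(* The library norm on row vectors is the sup norm. *)
Definition enorm v : R := Num.sqrt (\sum_(i < 2) v 0 i ^+ 2).

Lemma enormE v : enorm v = Num.sqrt (v 0 0 ^+ 2 + v 0 1 ^+ 2).
Proof.
rewrite /enorm !big_ord_recl big_ord0 addr0.
by congr (Num.sqrt (v 0 _ ^+ 2 + v 0 _ ^+ 2)); apply/val_inj.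
Qed.

Lemma enorm_ge0 v : 0 <= enorm v.
Proof. exact: sqrtr_ge0. Qed.

Lemma enorm_sqr v : enorm v ^+ 2 = v 0 0 ^+ 2 + v 0 1 ^+ 2.
Proof. by rewrite enormE sqr_sqrtr// addr_ge0// sqr_ge0. Qed.

Lemma enorm0_eq0 v : enorm v = 0 -> v = 0.
Proof.
move=> v0; have := enorm_sqr v; rewrite v0 expr0n/= => /esym/eqP.
rewrite paddr_eq0 ?sqr_ge0// !sqrf_eq0 => /andP[/eqP v00 /eqP v01].
apply/rowP => i; rewrite mxE; case: i => -[|[|//]] i2.
- by rewrite -[RHS]v00; congr (v 0 _); apply/val_inj.
- by rewrite -[RHS]v01; congr (v 0 _); apply/val_inj.
Qed.

Lemma enormZ a v : enorm (a *: v) = `|a| * enorm v.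
Proof.
by rewrite !enormE !mxE !exprMn -mulrDr sqrtrM ?sqr_ge0// sqrtr_sqr.
Qed.

Lemma ler_enormD v w : enorm (v + w) <= enorm v + enorm w.
Proof.
have expand (a b c d e : R) : a * c + b * d <= e ->
    (a + c) ^+ 2 + (b + d) ^+ 2 <=
    a ^+ 2 + b ^+ 2 + e *+ 2 + (c ^+ 2 + d ^+ 2) by nra.
have lagrange (a b c d : R) :
    (a * c + b * d) ^+ 2 <= (a ^+ 2 + b ^+ 2) * (c ^+ 2 + d ^+ 2).
  rewrite -subr_ge0 (_ : _ - _ = (a * d - b * c) ^+ 2) ?sqr_ge0//.
  by ring.
rewrite -(@ler_pXn2r _ 2)// ?nnegrE ?addr_ge0 ?enorm_ge0//.
rewrite sqrrD !enorm_sqr !mxE; apply: expand.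
have [|s0] := leP (v 0 0 * w 0 0 + v 0 1 * w 0 1) 0.
  by move=> /le_trans; apply; rewrite mulr_ge0 ?enorm_ge0.
rewrite -(@ler_pXn2r _ 2)// ?nnegrE ?mulr_ge0 ?enorm_ge0 ?(ltW s0)//.
by rewrite exprMn !enorm_sqr; exact: lagrange.
Qed.

Lemma enorm_le v : enorm v <= `|v 0 0| + `|v 0 1|.
Proof.
rewrite -(@ler_pXn2r _ 2)// ?nnegrE ?enorm_ge0 ?addr_ge0//.
rewrite enorm_sqr sqrrD !real_normK ?num_real//.
rewrite lerD2r lerDl; apply: mulrn_wge0; exact: mulr_ge0.
Qed.

End euclidean_plane.

Section weak_derivative.
Context {R : realType}.
Notation mu := (@lebesgue_measure R).

(* Functions on the circle are represented by 1-periodic functions on R. *)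
Definition test_fun (phi : R -> R) :=
  [/\ periodic phi 1, forall u, derivable phi u 1 & continuous (derive1 phi)].

Definition is_wderiv (f g : R -> 'rV[R]_2) :=
  forall i : 'I_2,
    mu.-integrable `[0, 1] (EFin \o (fun u => g u 0 i)) /\
    forall phi, test_fun phi ->
      \int[mu]_(u in `[0, 1]) (f u 0 i * derive1 phi u) =
      - \int[mu]_(u in `[0, 1]) (g u 0 i * phi u).

(* The choice is immaterial: weak derivatives are unique almost everywhere, see
   [wderiv_unique]. *)
Definition wderiv (f : R -> 'rV[R]_2) : R -> 'rV[R]_2 :=
  xget (fun=> 0) (is_wderiv f).

(* Each class of W^{1,1} of the circle has a unique continuous representative,
   its absolutely continuous one; it stands for the class. *)
Definition W11_set : set (R -> 'rV[R]_2) :=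
  [set f : R -> 'rV[R]_2 |
    [/\ periodic f 1, continuous f & exists g, is_wderiv f g]].

Definition W11_pred : {pred R -> 'rV[R]_2} := mem W11_set.

End weak_derivative.

Section W11_closed.
Context {R : realType}.
Notation mu := (@lebesgue_measure R).
Implicit Types f g : R -> 'rV[R]_2.

Let I01 : set (measurableTypeR R) := `[0, 1]%classic.

Let compactI01 : compact I01. Proof. exact: segment_compact. Qed.

Let measurableI01 : measurable I01. Proof. exact: measurable_itv. Qed.

Lemma integrable_continuous (h : R -> R) :
  continuous h -> mu.-integrable `[0, 1] (EFin \o h).
Proof.
move=> ch; apply: continuous_compact_integrable => //.
exact: continuous_subspaceT.
Qed.

Lemma integrable_mul_continuous (g h : R -> R) :
  mu.-integrable `[0, 1] (EFin \o g) -> continuous h ->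
  mu.-integrable `[0, 1] (EFin \o (fun u => g u * h u)).
Proof.
move=> ig ch.
have mh : measurable_fun I01 h.
  apply: measurable_funTS; exact: continuous_measurable_fun.
have bh : [bounded h x | x in I01].
  have /compact_bounded[M [_ mrt]] :=
    continuous_compact (continuous_subspaceT ch) compactI01.
  by exists M; split; rewrite ?num_real // => ? ? ? ?; exact: mrt.
rewrite (_ : _ \o _ = (EFin \o g) \* (EFin \o h))%E//.
exact: integrableMl.
Qed.

Lemma test_fun_continuous (phi : R -> R) : test_fun phi -> continuous phi.
Proof.
by move=> [_ dphi _] u; apply/differentiable_continuous/derivable1_diffP.
Qed.

Lemma continuous_coord f i : continuous f -> continuous (fun u => f u 0 i).
Proof.
move=> cf u; apply: (@continuous_comp _ _ _ f (fun M => M 0 i)).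
  exact: cf.
exact: coord_continuous.
Qed.

Lemma enorm_continuous : continuous (@enorm R).
Proof.
rewrite (_ : @enorm R =
    Num.sqrt \o (fun v : 'rV[R]_2 => v 0 0 ^+ 2 + v 0 1 ^+ 2)); last first.
  by apply/funext => w; rewrite enormE.
have csqr i : continuous (fun w : 'rV[R]_2 => w 0 i ^+ 2).
  move=> w; apply: (@continuous_comp _ _ _ (fun w : 'rV[R]_2 => w 0 i)
    (fun x : R => x ^+ 2)); first exact: coord_continuous.
  exact: exprn_continuous.
move=> v; apply: continuous_comp; last exact: sqrt_continuous.
exact: (cvgD (csqr 0 v) (csqr 1 v)).
Qed.

Lemma measurable_enorm (D : set R) (g : R -> 'rV[R]_2) : measurable D ->
  (forall i, measurable_fun D (fun u => g u 0 i)) ->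
  measurable_fun D (fun u => enorm (g u)).
Proof.
move=> mD mg; under eq_fun do rewrite enormE.
apply: (@measurableT_comp _ _ _ _ _ _ (@Num.sqrt R)).
  by apply: continuous_measurable_fun; exact: sqrt_continuous.
by apply: measurable_funD; under eq_fun do rewrite expr2;
  apply: measurable_funM.
Qed.

Lemma integrable_enorm (D : set R) (g : R -> 'rV[R]_2) : measurable D ->
  (forall i, mu.-integrable D (EFin \o (fun u => g u 0 i))) ->
  mu.-integrable D (EFin \o (fun u => enorm (g u))).
Proof.
move=> mD ig.
apply: (@le_integrable _ _ _ mu D mD _
    (fun u => (`|g u 0 0| + `|g u 0 1|)%:E)).
- apply/measurable_EFinP; apply: measurable_enorm => // i.
  by apply/measurable_EFinP; exact: (measurable_int mu).
- move=> u _ /=; rewrite lee_fin ger0_norm ?enorm_ge0// ger0_norm ?addr_ge0//.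
  exact: enorm_le.
- rewrite (_ : (fun u => _) = (fun u => `|(g u 0 0)%:E| + `|(g u 0 1)%:E|))%E//.
  by apply: integrableD => //; apply: integrable_abse; exact: ig.
Qed.

Lemma wderiv_lin (a : R) f1 f2 g1 g2 :
  continuous f1 -> continuous f2 -> is_wderiv f1 g1 -> is_wderiv f2 g2 ->
  is_wderiv (a *: f1 + f2) (a *: g1 + g2).
Proof.
move=> cf1 cf2 w1 w2 i; have [ig1 w1i] := w1 i; have [ig2 w2i] := w2 i.
have iag1 : mu.-integrable `[0, 1] (EFin \o (fun u => a * g1 u 0 i)).
  rewrite (_ : _ \o _ = (fun u => a%:E * (g1 u 0 i)%:E)%E)//.
  exact: integrableZl.
split.
  rewrite (_ : _ \o _ =
      (fun u => (a * g1 u 0 i)%:E + (g2 u 0 i)%:E)%E); last first.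
    by apply/funext => u /=; rewrite !mxE.
  exact: integrableD.
move=> phi tphi; have cphi := test_fun_continuous tphi.
have [_ _ cdphi] := tphi.
transitivity (\int[mu]_(u in `[0, 1])
    (a * (f1 u 0 i * derive1 phi u) + f2 u 0 i * derive1 phi u)).
  by apply: eq_Rintegral => u _; rewrite !mxE mulrDl mulrA.
have if1 : mu.-integrable `[0, 1] (EFin \o (fun u => f1 u 0 i * derive1 phi u)).
  by apply: integrable_mul_continuous => //;
     apply: integrable_continuous; exact: continuous_coord.
have if2 : mu.-integrable `[0, 1] (EFin \o (fun u => f2 u 0 i * derive1 phi u)).
  by apply: integrable_mul_continuous => //;
     apply: integrable_continuous; exact: continuous_coord.
have igp1 := integrable_mul_continuous ig1 cphi.
have igp2 := integrable_mul_continuous ig2 cphi.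
rewrite RintegralD//; last first.
  rewrite (_ : _ \o _ = (fun u => a%:E * (f1 u 0 i * derive1 phi u)%:E)%E)//.
  exact: integrableZl.
rewrite RintegralZl// w1i// w2i// mulrN -opprD -RintegralZl// -RintegralD//.
  by congr (- _); apply: eq_Rintegral => u _; rewrite !mxE mulrDl mulrA.
rewrite (_ : _ \o _ = (fun u => a%:E * (g1 u 0 i * phi u)%:E)%E)//.
exact: integrableZl.
Qed.

Lemma W11_submod_closed : submod_closed (@W11_pred R).
Proof.
split.
  apply/mem_set; split; first by [].
    by move=> u; exact: cvg_cst.
  exists (fun=> 0) => i; split.
    rewrite (_ : _ \o _ = cst 0%E); first exact: integrable0.
    by apply/funext => u /=; rewrite mxE.
  move=> phi _; rewrite /Rintegral !integral0_eq ?oppr0// => u _.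
    by rewrite mxE mul0r.
  by rewrite mxE mul0r.
move=> a f1 f2 /set_mem[p1 c1 [g1 w1]] /set_mem[p2 c2 [g2 w2]].
apply/mem_set; split.
- by move=> u; rewrite !fctE p1 p2.
- by move=> u; apply: cvgD; [apply: cvgZl_tmp; exact: c1|exact: c2].
- by exists (a *: g1 + g2); exact: wderiv_lin.
Qed.

HB.instance Definition _ := GRing.isSubmodClosed.Build R (R -> 'rV[R]_2)
  (@W11_pred R) W11_submod_closed.

End W11_closed.

Section wderiv_uniqueness.
Context {R : realType}.
Notation mu := (@lebesgue_measure R).

(* On [0, 1], phase b is positive on ]0, b[ and negative on ]b, 1[, so that
   step b n is a test function which converges to the indicator of ]0, b[. *)
Let phase (b u : R) : R := sin (pi * u) * sin (pi * (b - u)).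

Let step (b : R) (n : nat) (u : R) : R := (1 + expR (- (n%:R * phase b u)))^-1.

Let phase_periodic b : periodic (phase b) 1.
Proof.
move=> u; rewrite /phase mulrDr mulr1 sinDpi opprD addrA mulrBr mulr1.
have -> : sin (pi * (b - u) - pi) = - sin (pi * (b - u)).
  by rewrite -[in RHS](subrK pi (pi * (b - u))) sinDpi opprK.
by rewrite mulrNN.
Qed.

Let dphase (b u : R) : R :=
  pi * cos (pi * u) * sin (pi * (b - u)) -
  pi * sin (pi * u) * cos (pi * (b - u)).

Let is_derive_phase (b u : R) : is_derive u 1 (phase b) (dphase b u).
Proof.
rewrite /phase.
apply: is_derive_eq.
rewrite /dphase /GRing.scale/=.
ring.
Qed.

Let step_den_gt0 b n u : 0 < 1 + expR (- (n%:R * phase b u)).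
Proof. by rewrite ltr_pwDl// expR_ge0. Qed.

Let dstep b n u := n%:R * dphase b u * expR (- (n%:R * phase b u)) *
   step b n u ^+ 2.

Let is_derive_step (b : R) n (u : R) : is_derive u 1 (step b n) (dstep b n u).
Proof.
rewrite /step.
have dden : is_derive u (1 : R) (fun v => 1 + expR (- (n%:R * phase b v)))
    (- (n%:R * dphase b u) * expR (- (n%:R * phase b u))).
  have dp := is_derive_phase b u.
  by apply: is_derive_eq; rewrite /GRing.scale/=; ring.
have den0 : 1 + expR (- (n%:R * phase b u)) != 0 by rewrite gt_eqF.
pose den (v : R) : R := 1 + expR (- (n%:R * phase b v)).
apply: (is_derive_eq (@is_deriveV _ den _ _ _ den0 dden)).
by rewrite /dstep /step /den /GRing.scale/= exprVn; ring.
Qed.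

Let test_fun_step b n : test_fun (step b n).
Proof.
split.
- by move=> u; rewrite /step phase_periodic.
- by move=> u; have [] := is_derive_step b n u.
- have -> : derive1 (step b n) = dstep b n.
    by apply/funext => u; rewrite derive1E; have [_ ->] := is_derive_step b n u.
  have derC (h : R -> R) : (forall v : R, derivable h v 1) -> continuous h.
    by move=> dh v; apply/differentiable_continuous/derivable1_diffP.
  have cstep : continuous (step b n).
    by apply: derC => v; have [] := is_derive_step b n v.
  have cdphase : continuous (dphase b) by apply: derC => v; exact: ex_derive.
  have cexp : continuous (fun v : R => expR (- (n%:R * phase b v))).
    apply: derC => v; have dp := is_derive_phase b v; exact: ex_derive.
  move=> v; rewrite /dstep; apply: cvgM; last first.
    by rewrite expr2; under eq_fun do rewrite expr2; apply: cvgM; exact: cstep.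
  apply: cvgM; last exact: cexp.
  by apply: cvgM; [exact: cvg_cst|exact: cdphase].
Qed.

Let step_ge0 b n u : 0 <= step b n u.
Proof. by rewrite invr_ge0 ltW. Qed.

Let step_le1 b n u : step b n u <= 1.
Proof. by rewrite invf_le1// lerDl expR_ge0. Qed.

Let phase_gt0 (b u : R) : b <= 1 -> 0 < u -> u < b -> 0 < phase b u.
Proof.
move=> b1 u0 ub; rewrite /phase mulr_gt0// sin_gt0_pi//.
  by rewrite mulr_gt0 ?pi_gt0//= gtr_pMr ?pi_gt0//; lra.
by rewrite mulr_gt0 ?pi_gt0 ?subr_gt0//= gtr_pMr ?pi_gt0//; lra.
Qed.

Let phase_lt0 (b u : R) : 0 < b -> b < u -> u < 1 -> phase b u < 0.
Proof.
move=> b0 bu u1; rewrite /phase pmulr_rlt0; last first.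
  rewrite sin_gt0_pi// mulr_gt0 ?pi_gt0 ?(lt_trans b0)//=.
  by rewrite gtr_pMr ?pi_gt0.
rewrite -opprB mulrN sinN oppr_lt0 sin_gt0_pi//.
rewrite mulr_gt0 ?pi_gt0 ?subr_gt0//= gtr_pMr ?pi_gt0//; lra.
Qed.

Let step_cvg (b u : R) : 0 < b -> b <= 1 -> 0 < u -> u < 1 -> u != b ->
  step b n u @[n --> \oo] --> (\1_(`]0, b]%classic) u : R).
Proof.
move=> b0 b1 u0 u1 ub; rewrite /step indicE.
have infty (c : R) : 0 < c -> expR (- (n%:R * c)) @[n --> \oo] --> (0 : R).
  move=> c0; have nc : n%:R * c @[n --> \oo] --> +oo.
    apply/cvgryPge => A; near=> n; rewrite -ler_pdivrMr//.
    by near: n; exact: nbhs_infty_ger.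
  exact: (cvg_comp _ _ nc (@cvgr_expR R)).
have [ltub|leub] := ltP u b.
  rewrite mem_set/=; last by rewrite in_itv/= u0 ltW.
  rewrite [X in _ --> X](_ : _ = (1 + 0)^-1 :> R); last by rewrite addr0 invr1.
  apply: cvgV; first by rewrite addr0 oner_neq0.
  by apply: cvgD; [exact: cvg_cst|apply: infty; exact: phase_gt0].
have ltbu : b < u by rewrite lt_neqAle eq_sym ub.
rewrite memNset/=; last by rewrite in_itv/= u0 leNgt ltbu.
have p0 : 0 < - phase b u by rewrite oppr_gt0 phase_lt0.
apply: (@squeeze_cvgr _ _ _ _ (cst 0) (fun n => expR (- (n%:R * - phase b u)))).
- near=> n; rewrite step_ge0/= /step mulrN opprK -[leRHS]invrK -expRN.
  by rewrite lef_pV2 ?posrE ?expR_gt0// lerDr.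
- exact: cvg_cst.
- exact: infty.
Unshelve. all: by end_near. Qed.

Let I01 : set (measurableTypeR R) := `[0, 1]%classic.

Let measurableI01 : measurable I01. Proof. exact: measurable_itv. Qed.

Lemma integral_test_fun_eq0 (d : R -> R) :
  mu.-integrable `[0, 1] (EFin \o d) ->
  (forall phi, test_fun phi -> \int[mu]_(u in `[0, 1]) (d u * phi u) = 0) ->
  forall b : R, 0 < b -> b <= 1 -> \int[mu]_(u in `[0, b]) d u = 0.
Proof.
move=> id dphi b b0 b1.
have intd n : mu.-integrable I01 (EFin \o (fun u => d u * step b n u)).
  by apply: integrable_mul_continuous => //; apply: test_fun_continuous.
have int0 n : (\int[mu]_(u in I01) (d u * step b n u)%:E = 0)%E.
  have := dphi _ (test_fun_step b n); rewrite /Rintegral => h.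
  by rewrite -(fineK (integrable_fin_num measurableI01 (intd n))); congr EFin.
have mlim :
    measurable_fun I01 (EFin \o (fun u => d u * \1_(`]0, b]%classic) u)).
  apply/measurable_EFinP; apply: measurable_funM.
    by apply/measurable_EFinP; exact: (measurable_int mu).
  by apply: measurable_indic; exact: measurable_itv.
have exc : mu.-negligible [set 0; b; 1].
  apply/negligibleP; last first.
    by apply: countable_lebesgue_measure0; exact/finite_set_countable.
  by apply: measurableU; [apply: measurableU|]; exact: measurable_set1.
have cvg_ae : {ae mu, forall u, I01 u ->
    (d u * step b n u)%:E @[n --> \oo] --> (d u * \1_(`]0, b]%classic) u)%:E}.
  apply: negligibleS exc => u /= /not_implyP[].
  rewrite /I01/= in_itv/= => /andP[]; rewrite !le_eqVlt.
  move=> /predU1P[->|u0]; first by do 2 left.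
  move=> /predU1P[->|u1]; first by right.
  move=> ncvg; left; right; apply: contrapT => /eqP ub; apply: ncvg.
  apply: cvg_EFin; first by apply: nearW => n.
  by apply: cvgM; [exact: cvg_cst|exact: step_cvg].
have bound_ae : {ae mu, forall u (n : nat), I01 u ->
    (`|(d u * step b n u)%:E| <= `|(d u)%:E|)%E}.
  apply: aeW => u n _; rewrite lee_fin normrM ler_piMr//.
  by rewrite ger0_norm ?step_ge0.
have [_ _] := dominated_convergence measurableI01
  (fun n => measurable_int mu (intd n)) mlim cvg_ae (integrable_abse id)
  bound_ae.
rewrite (_ : (fun n => _) = cst 0%E); last exact/funext.
move=> /(cvg_unique _ (cvg_cst 0%E)) => /(_ (@ereal_hausdorff R)) int_eq0.
rewrite /Rintegral -integral_itv_obnd_cbnd; last first.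
  apply: (measurable_funS measurableI01); last exact: measurable_int id.
  move=> u; rewrite /I01/= !in_itv/= => /andP[u0 ub]; apply/andP; split.
    exact: ltW.
  exact: le_trans b1.
rewrite (_ : `]0, b]%classic = I01 `&` `]0, b]); last first.
  apply/seteqP; split=> u /=; last by move=> [].
  rewrite /I01/= !in_itv/= => /andP[u0 ub]; split; apply/andP; split => //.
    exact: ltW.
  exact: le_trans b1.
rewrite integral_mkcondr epatch_indic.
rewrite [X in fine X](_ : _ = 0%E)//.
Qed.

Lemma test_fun_ae_eq0 (d : R -> R) :
  mu.-integrable `[0, 1] (EFin \o d) ->
  (forall phi, test_fun phi -> \int[mu]_(u in `[0, 1]) (d u * phi u) = 0) ->
  {ae mu, forall u, `[0, 1]%classic u -> d u = 0}.
Proof.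
move=> id /(integral_test_fun_eq0 id) d0.
have iD : mu.-integrable setT (EFin \o (d \_ I01)).
  by rewrite -restrict_EFin; exact/(integrable_mkcond _ measurableI01).
have idD (y : R) : mu.-integrable `]-oo, y] (EFin \o (d \_ I01)).
  exact: integrableS iD.
have F0 (y : R) : \int[mu]_(t in `]-oo, y]) (d \_ I01) t = 0.
  rewrite -Rintegral_mkcondr; have [y0|y0|->] := ltgtP y 0.
  - rewrite (_ : _ `&` _ = set0) ?Rintegral_set0//.
    rewrite -subset0 => u; rewrite /I01/= !in_itv/= => -[uy /andP[u0 _]].
    by have := lt_le_trans (le_lt_trans uy y0) u0; rewrite ltxx.
  - have [y1|y1] := leP y 1.
      rewrite (_ : _ `&` _ = `[0, y]%classic) ?d0//.
      apply/seteqP; split=> u; rewrite /I01/= !in_itv/=.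
        by move=> [-> /andP[-> _]].
      by move=> /andP[u0 uy]; split=> //; rewrite u0 (le_trans uy).
    rewrite (_ : _ `&` _ = I01) ?d0//.
    apply/seteqP; split=> u; rewrite /I01/= !in_itv/=; first by case.
    move=> /andP[u0 u1]; split; last by rewrite u0.
    by rewrite (le_trans u1)// ltW.
  - rewrite (_ : _ `&` _ = [set 0]) ?Rintegral_set1//.
    apply/seteqP; split=> u; rewrite /I01/= !in_itv/=.
      by move=> [u0 /andP[u0' _]]; apply/le_anti; rewrite u0.
    by move=> ->; rewrite lexx ler01.
have := FTC1Ny idD (integrable_locally_restrict measurableI01 id).
apply: filterS; first exact: (ae_filter_ringOfSetsType mu).
move=> u; under eq_fun do rewrite F0.
rewrite derive1_cst patchE => -[_ + uI].
by rewrite mem_set.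
Qed.

Lemma wderiv_unique (f g1 g2 : R -> 'rV[R]_2) :
  is_wderiv f g1 -> is_wderiv f g2 ->
  {ae mu, forall u, `[0, 1]%classic u -> g1 u = g2 u}.
Proof.
move=> w1 w2.
have ae_coord i : {ae mu, forall u, `[0, 1]%classic u -> g1 u 0 i = g2 u 0 i}.
  have [ig1 w1i] := w1 i; have [ig2 w2i] := w2 i.
  have id : mu.-integrable `[0, 1] (EFin \o (fun u => g1 u 0 i - g2 u 0 i)).
    rewrite (_ : _ \o _ = (fun u => (g1 u 0 i)%:E - (g2 u 0 i)%:E)%E)//.
    exact: integrableB.
  have : {ae mu, forall u, `[0, 1]%classic u -> g1 u 0 i - g2 u 0 i = 0}.
    apply: test_fun_ae_eq0 => // phi tphi.
    have cphi := test_fun_continuous tphi.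
    under eq_Rintegral do rewrite mulrBl.
    rewrite RintegralB//; [|exact: integrable_mul_continuous..].
    apply/eqP; rewrite subr_eq0 -eqr_opp -w1i// -w2i//.
  apply: filterS; first exact: (ae_filter_ringOfSetsType mu).
  by move=> u + uI => /(_ uI)/eqP; rewrite subr_eq0 => /eqP.
have := ae_coord 1; have := ae_coord 0.
apply: filterS2; first exact: (ae_filter_ringOfSetsType mu).
move=> u h0 h1 uI; apply/rowP => i.
have [->|->] : i = 0 \/ i = 1.
  by case: i => -[|[|//]] ?; [left|right]; exact/val_inj.
- exact: h0.
- exact: h1.
Qed.

End wderiv_uniqueness.

Record W11 (R : realType) :=
  MkW11 { W11_fun :> R -> 'rV[R]_2 ; W11_funP : W11_fun \in W11_pred }.

HB.instance Definition _ (R : realType) := [isSub for @W11_fun R].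
HB.instance Definition _ (R : realType) := [Choice of W11 R by <:].
HB.instance Definition _ (R : realType) :=
  [SubChoice_isSubLmodule of W11 R by <:].

Section W11_norm.
Context {R : realType}.
Notation mu := (@lebesgue_measure R).
Implicit Types f g : W11 R.

Let I01 : set (measurableTypeR R) := `[0, 1]%classic.

Let measurableI01 : measurable I01. Proof. exact: measurable_itv. Qed.

Lemma W11_periodic f : periodic f 1.
Proof. by have /set_mem[] := W11_funP f. Qed.

Lemma W11_continuous f : continuous f.
Proof. by have /set_mem[] := W11_funP f. Qed.

Lemma wderivP f : is_wderiv f (wderiv f).
Proof. by have /set_mem[_ _ [g wg]] := W11_funP f; exact: xgetI wg. Qed.

Lemma integrable_W11_coord f i :
  mu.-integrable `[0, 1] (EFin \o (fun u => f u 0 i)).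
Proof. exact/integrable_continuous/continuous_coord/W11_continuous. Qed.

Lemma integrable_wderiv_coord f i :
  mu.-integrable `[0, 1] (EFin \o (fun u => wderiv f u 0 i)).
Proof. by have [] := wderivP f i. Qed.

Lemma integrable_enorm_W11 f :
  mu.-integrable `[0, 1] (EFin \o (fun u => enorm (f u))).
Proof. by apply: integrable_enorm => // i; exact: integrable_W11_coord. Qed.

Lemma integrable_enorm_wderiv f :
  mu.-integrable `[0, 1] (EFin \o (fun u => enorm (wderiv f u))).
Proof. by apply: integrable_enorm => // i; exact: integrable_wderiv_coord. Qed.

Lemma wderiv_linE (a : R) f g :
  {ae mu, forall u, `[0, 1]%classic u ->
    wderiv (a *: f + g) u = a *: wderiv f u + wderiv g u}.
Proof.
apply: (@wderiv_unique _ (a *: f + g : W11 R) _ (a *: wderiv f + wderiv g)).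
  exact: wderivP.
by apply: wderiv_lin; do ?[exact: W11_continuous|exact: wderivP].
Qed.

Lemma enorm_wderiv_linE (a : R) f g :
  \int[mu]_(u in `[0, 1]) enorm (wderiv (a *: f + g) u) =
  \int[mu]_(u in `[0, 1]) enorm (a *: wderiv f u + wderiv g u).
Proof.
congr fine; apply: ae_eq_integral => //.
- exact: measurable_int (integrable_enorm_wderiv _).
- apply/measurable_EFinP; apply: measurable_enorm => // i.
  rewrite (_ : (fun u => _) =
      (fun u => a * wderiv f u 0 i + wderiv g u 0 i)); last first.
    by apply/funext => u; rewrite !mxE.
  apply: measurable_funD; last first.
    by apply/measurable_EFinP;
      exact: measurable_int (integrable_wderiv_coord _ _).
  apply: measurable_funM => //.
  by apply/measurable_EFinP;
      exact: measurable_int (integrable_wderiv_coord _ _).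
- have := wderiv_linE a f g.
  apply: filterS; first exact: (ae_filter_ringOfSetsType mu).
  by move=> u + uI => /(_ uI) ->.
Qed.

Definition W11_norm f : R :=
  \int[mu]_(u in `[0, 1]) enorm (f u) +
  \int[mu]_(u in `[0, 1]) enorm (wderiv f u).

Lemma ler_W11_normD f g : W11_norm (f + g) <= W11_norm f + W11_norm g.
Proof.
rewrite /W11_norm addrACA lerD//.
  rewrite -RintegralD//; [|exact: integrable_enorm_W11..].
  apply: le_Rintegral => //; first exact: integrable_enorm_W11.
    rewrite (_ : _ \o _ = (fun u => (enorm (f u))%:E + (enorm (g u))%:E)%E)//.
    by apply: integrableD => //; exact: integrable_enorm_W11.
  by move=> u _; exact: ler_enormD.
rewrite -[f in leLHS]scale1r enorm_wderiv_linE.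
rewrite -RintegralD//; [|exact: integrable_enorm_wderiv..].
apply: le_Rintegral => //.
- apply: integrable_enorm => // i.
  rewrite (_ : _ \o _ =
      (fun u => (wderiv f u 0 i)%:E + (wderiv g u 0 i)%:E)%E); last first.
    by apply/funext => u /=; rewrite scale1r !mxE.
  by apply: integrableD => //; exact: integrable_wderiv_coord.
- rewrite (_ : _ \o _ =
      (fun u => (enorm (wderiv f u))%:E + (enorm (wderiv g u))%:E)%E)//.
  by apply: integrableD => //; exact: integrable_enorm_wderiv.
- by move=> u _; rewrite scale1r; exact: ler_enormD.
Qed.

Lemma W11_normZ (a : R) f : W11_norm (a *: f) = `|a| * W11_norm f.
Proof.
have wdZ : \int[mu]_(u in `[0, 1]) enorm (wderiv (a *: f) u) =
    \int[mu]_(u in `[0, 1]) (`|a| * enorm (wderiv f u)).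
  have -> : a *: f = (a - 1) *: f + f by rewrite scalerBl scale1r subrK.
  rewrite enorm_wderiv_linE; apply: eq_Rintegral => u _.
  by rewrite scalerBl scale1r subrK enormZ.
rewrite /W11_norm wdZ mulrDr -RintegralZl//; last exact: integrable_enorm_W11.
rewrite -RintegralZl//; last exact: integrable_enorm_wderiv.
by congr (_ + _); apply: eq_Rintegral => u _; rewrite -enormZ.
Qed.

Lemma W11_norm0_eq0 f : W11_norm f = 0 -> f = 0.
Proof.
move=> /eqP; rewrite paddr_eq0;
  [|by apply: Rintegral_ge0 => u _; exact: enorm_ge0..].
move=> /andP[/eqP f0 _].
have ce : continuous (fun u => enorm (f u)).
  by move=> u; apply: continuous_comp;
    [exact: W11_continuous|exact: enorm_continuous].
have F0 (x : R) : x <= 1 -> \int[mu]_(u in `[0, x]) enorm (f u) = 0.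
  move=> x1; apply/le_anti/andP; split; last first.
    by apply: Rintegral_ge0 => u _; exact: enorm_ge0.
  have sub : `[0, x]%classic `<=` I01.
    move=> u; rewrite /I01/= !in_itv/= => /andP[u0 ux].
    by rewrite u0 (le_trans ux).
  have ix : mu.-integrable `[0, x] (EFin \o (fun u => enorm (f u))).
    exact: integrableS (integrable_enorm_W11 f).
  rewrite -[leRHS]f0 /Rintegral fine_le//.
  - exact: (integrable_fin_num _ ix).
  - exact: (integrable_fin_num measurableI01 (integrable_enorm_W11 f)).
  - apply: ge0_subset_integral => //.
    + exact: measurable_int (integrable_enorm_W11 f).
    + by move=> u _; rewrite lee_fin enorm_ge0.
have fI (x : R) : 0 < x -> x < 1 -> enorm (f x) = 0.
  move=> x0 x1.
  have [_ <-] := @continuous_FTC1_closed R (fun u => enorm (f u)) 0 x 1 x1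
    (integrable_enorm_W11 f) x0 (ce x).
  rewrite derive1E.
  rewrite (@near_eq_derive _ _ _ _ (cst 0)) ?oner_neq0//.
    by rewrite derive_cst.
  by near=> y; apply: F0; apply: ltW; near: y; exact: lt_nbhsl.
have fx (x : R) : 0 <= x -> x < 1 -> enorm (f x) = 0.
  rewrite le_eqVlt => /predU1P[<- _|]; last exact: fI.
  have c0 : enorm (f u) @[u --> (0:R)^'+] --> enorm (f 0).
    by apply: cvg_at_right_filter; exact: ce.
  apply: (cvg_unique _ c0); first exact: Rhausdorff.
  apply: (@cvg_trans _ (0 @[u --> (0:R)^'+])); last exact: cvg_cst.
  apply: near_eq_cvg; by near=> u; rewrite fI.
have per (z : int) (x : R) : f (x + z%:~R) = f x.
  case: (intP z) => [|n|n]; first by rewrite addr0.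
    by rewrite -pmulrn (periodicn (@W11_periodic f)).
  by rewrite mulrNz -pmulrn -(periodicn (@W11_periodic f) n.+1) subrK.
apply/val_inj/funext => x; apply: enorm0_eq0.
rewrite -[LHS]/(enorm (f x)) -[x](subrK (Num.floor x)%:~R) per; apply: fx.
  by rewrite subr_ge0 floor_le.
by rewrite ltrBlDl -[X in _ < _ + X]/(1%:~R) -intrD floorD1_gt.
Unshelve. all: by end_near. Qed.

HB.instance Definition _ := Lmodule_isNormed.Build R (W11 R)
  ler_W11_normD W11_normZ W11_norm0_eq0.

End W11_norm.

Section curve_flow.
Context {R : realType}.
Notation mu := (@lebesgue_measure R).
Implicit Types (gamma : W11 R) (lambda b : R) (T : \bar R) (X : R -> W11 R).

Definition cosh (x : R) := (expR x + expR (- x)) / 2.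
Definition sinh (x : R) := (expR x - expR (- x)) / 2.

Definition curve_length gamma : R :=
  \int[mu]_(u in `[0, 1]) enorm (wderiv gamma u).

Definition circle_kernel lambda (x : R) : R :=
  let y := x - (Num.floor x)%:~R in
  - cosh ((`|y| - 1 / 2) / lambda) / (2 * lambda * sinh (1 / (2 * lambda))).

Definition arclen gamma (u : R) : R :=
  (curve_length gamma)^-1 * \int[mu]_(tau in `[0, u]) enorm (wderiv gamma tau).

Definition curve_conv lambda gamma (u : R) : 'rV[R]_2 :=
  \row_i \int[mu]_(v in `[0, 1])
    (gamma v 0 i * circle_kernel lambda (arclen gamma v - arclen gamma u) *
     (enorm (wderiv gamma v) / curve_length gamma)).

Definition flow_field lambda b gamma (u : R) : 'rV[R]_2 :=
  if curve_length gamma == 0 then 0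
  else - (curve_length gamma `^ (b - 2) / lambda ^+ 2) *:
         (gamma u + curve_conv lambda gamma u).

Definition time_itv T : set R := [set t | 0 <= t /\ (t%:E < T)%E].

(* X is of class C^1 on I with derivative dX; derivatives are relative to I,
   hence one-sided at an endpoint of I. *)
Definition C1_on {V : normedModType R} (I : set R) (X dX : R -> V) :=
  (forall t, I t ->
     (s - t)^-1 *: (X s - X t) @[s --> within I t^'] --> dX t) /\
  {within I, continuous dX}.

(* [wderiv gamma] and [arclen gamma] are meaningful on [0, 1] only, which is
   enough to determine the 1-periodic function dX t. *)
Definition flow_solution lambda b T X :=
  exists2 dX : R -> W11 R, C1_on (time_itv T) X dX &
    forall t, time_itv T t -> forall u, 0 <= u <= 1 ->
      dX t u = flow_field lambda b (X t) u.

Definition positive_length T X :=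
  forall t, time_itv T t -> 0 < curve_length (X t).

(* T is the maximal existence time: X does not extend, as a positive-length
   solution, beyond T. *)
Definition maximal_pl_solution lambda b T X :=
  [/\ (0 < T)%E, flow_solution lambda b T X, positive_length T X &
    forall S Z, flow_solution lambda b S Z -> positive_length S Z ->
      (forall t, time_itv T t -> Z t = X t) -> (S <= T)%E].

End curve_flow.

(* Main.v *)
Require Import Defs.
From HB Require Import structures.
From mathcomp Require Import all_boot all_order all_algebra.
From mathcomp Require Import all_classical all_reals all_analysis.
From mathcomp Require Import measurable_realfun ring lra.

Set Implicit Arguments.
Unset Strict Implicit.
Unset Printing Implicit Defensive.

Import Order.TTheory GRing.Theory Num.Theory.
Import numFieldNormedType.Exports.

Local Open Scope classical_set_scope.
Local Open Scope ring_scope.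

(** The two fields differ by a power of the length: F_a is
    L^(a - 2) F_2. So if Y solves the equation with exponent 2 and theta is the
    time with derivative L(Y)^(2 - a), then Z = Y o theta^-1 solves the equation
    with exponent a, on [0, S) where S is the supremum of theta. Two facts are
    needed to conclude.

    The length of Y never vanishes ([flow2_positive_length]), so that theta is
    an increasing C^1 function and Z is a positive-length solution. This holds
    because the field of exponent 2 satisfies L(F_2 gamma) <= K L(gamma)
    ([curve_length_flow2_le]), whence L(Y) decreases at most exponentially.

    Positive-length solutions are unique ([flow_unique]), so that X and Z agree
    where both are defined. If S exceeded the maximal time T_a, then Z would be
    a positive-length extension of X beyond T_a; hence S <= T_a, each
    theta t < S lies in the domain of X, and X (theta t) = Z (theta t) = Y t.
    Uniqueness follows by Gronwall's inequality from a Lipschitz estimate of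
    the field on bounded sets of curves whose lengths stay away from 0
    ([flow_lipschitz]).

    Both estimates rest on a formula for the derivative of the field
    ([wderiv_flow]): differentiation commutes with the convolution in
    arclength, that is, the convolution of gamma with the kernel G has the weak
    derivative
      u |-> |gamma' u| / L * \int gamma' v G(rho v - rho u) dv.
    Here gamma' enters linearly and G without derivative, while G is Lipschitz
    although its derivative jumps at 0. To prove the formula, take an
    antiderivative K of G; an integration by parts turns the convolution into
      K(1) gamma 0 - \int gamma' v K(rho v - rho u) dv,
    which can be differentiated in u by the chain rule, K being C^1
    ([curve_conv_by_parts], [is_primitive_curve_conv]).

    These manipulations take place among primitives of integrable functions on
    [0, 1]. Their chain rule and product rule follow, like Gronwall's
    inequality, from one comparison lemma for right Dini derivatives
    ([right_dini_le]), and the lemma of du Bois-Reymond identifies them with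
    functions that have a weak derivative ([is_primitive_weak],
    [weak_is_primitive]). *)

(** * Dini derivatives and Gronwall's inequality *)

Section real_calculus.
Context {R : realType}.

Lemma within_cvg {T S : topologicalType} (A : set T) (f : T -> S) x :
  {within A, continuous f} -> A x -> f y @[y --> within A (nbhs x)] --> f x.
Proof. by move=> /subspace_continuousP; apply. Qed.

Lemma within_continuousI {T S : topologicalType} (A : set T) (f : T -> S) :
  (forall x, A x -> f y @[y --> within A (nbhs x)] --> f x) ->
  {within A, continuous f}.
Proof. by move=> cf; apply/subspace_continuousP. Qed.

Lemma continuous_comp_within {T S U : topologicalType} (A : set T) (f : T -> S)
    (h : S -> U) :
  continuous h -> {within A, continuous f} -> {within A, continuous (h \o f)}.
Proof.
move=> ch cf; apply: within_continuousI => x Ax.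
exact: (cvg_comp _ _ (within_cvg cf Ax) (ch (f x))).
Qed.

(** The points t of [a, b] with h t - e M t <= h a - e M a have a supremum which
    belongs to them by continuity, and which cannot lie before b because the
    hypothesis would carry the inequality further to the right; then e tends
    to 0. With M t = t this compares the endpoint values of a function whose
    right Dini derivative is nonpositive; with M an integral of |g| it serves
    for functions that are only absolutely continuous. *)
Lemma right_dini_le (h M : R -> R) (a b : R) : a <= b ->
  {within `[a, b], continuous h} -> {within `[a, b], continuous M} ->
  (forall t, a <= t < b -> forall e, 0 < e ->
     \forall s \near t^'+, h s - h t <= e * (M s - M t)) ->
  h b <= h a.
Proof.
move=> ab ch cM dini.
have key e : 0 < e -> h b - e * M b <= h a - e * M a.
  move=> e0; pose k t := h t - e * M t.
  pose A : set R := [set t | a <= t <= b /\ k t <= k a].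
  have Aa : A a by split => //; rewrite lexx ab.
  have supA : has_sup A by split; [exists a|exists b => t [/andP[]]].
  have aA : a <= sup A by apply: ub_le_sup => //; exact: supA.2.
  have Ab : sup A <= b by apply: ge_sup; [exists a|move=> t [/andP[]]].
  have cA : closure A (sup A) by exact: closure_sup supA.1 supA.2.
  have csup : k t @[t --> within `[a, b] (nbhs (sup A))] --> k (sup A).
    have sab : `[a, b]%classic (sup A) by rewrite /= in_itv/= aA Ab.
    apply: cvgB; first exact: within_cvg.
    by apply: cvgM; [exact: cvg_cst|exact: within_cvg].
  have ksup : k (sup A) <= k a.
    rewrite leNgt; apply/negP => kas.
    have : \forall t \near within `[a, b] (nbhs (sup A)), k a < k t.
      by apply: (cvgr_gt _ csup).
    rewrite near_withinE => /cA[t [[tab kt] /(_ _)]].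
    by rewrite /= in_itv/= => /(_ tab); rewrite ltNge kt.
  have [sb|sb] := eqVneq (sup A) b; first by rewrite /k sb in ksup.
  have {}sb : sup A < b by rewrite lt_neqAle sb.
  have st : a <= sup A < b by rewrite aA.
  have : \forall s \near (sup A)^'+, A s /\ sup A < s.
    near=> s; have ss : sup A < s by near: s; exact: nbhs_right_gt.
    split => //; split.
      rewrite (le_trans aA) ?ltW//=; near: s; exact: nbhs_right_le.
    have : h s - h (sup A) <= e * (M s - M (sup A)) by near: s; exact: dini.
    by move: ksup; rewrite /k; lra.
  move=> /(@filter_ex _ _ (at_right_proper_filter _))[s [As ss]].
  by have := ub_le_sup supA.2 As; rewrite leNgt ss.
have [MM|MM] := eqVneq (M b) (M a).
  by have := key 1 ltr01; rewrite MM lerD2r.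
apply/ler_addgt0Pr => e e0.
have n0 : 0 < `|M b - M a| by rewrite normr_gt0 subr_eq0.
have := key (e / `|M b - M a|) (divr_gt0 e0 n0).
have : e / `|M b - M a| * (M b - M a) <= e.
  by rewrite mulrAC ler_pdivrMr// ler_pM2l// ler_norm.
lra.
Unshelve. all: by end_near. Qed.

Lemma is_derive_taylor1 (f : R -> R) (x l : R) : is_derive x (1 : R) f l ->
  forall e : R, 0 < e ->
    \forall y \near x, `|f y - f x - l * (y - x)| <= e * `|y - x|.
Proof.
move=> [df dfl] e e0.
have : h^-1 *: (f (h *: 1 + x) - f x) @[h --> 0^'] --> l by rewrite -dfl.
move=> /cvgrPdist_le/(_ _ e0)/= [r /= r0 fr].
exists r => //= y xy; have [->|yx] := eqVneq y x.
  by rewrite !subrr mulr0 subr0 normr0 mulr0.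
have yx0 : y - x != 0 by rewrite subr_eq0.
have := fr (y - x); rewrite /= sub0r normrN distrC => /(_ xy yx0).
rewrite /GRing.scale/= mulr1 subrK => h.
rewrite (_ : _ - _ = ((y - x)^-1 * (f y - f x) - l) * (y - x)); last first.
  by rewrite mulrBl mulrAC mulVf// mul1r.
by rewrite normrM distrC; apply: ler_wpM2r => //; rewrite distrC.
Qed.

Lemma is_derive_slope (f : R -> R) (x l : R) : is_derive x (1 : R) f l ->
  (y - x)^-1 * (f y - f x) @[y --> x^'] --> l.
Proof.
move=> dfx; apply/cvgrPdist_le => e e0.
have : \forall y \near x^', `|f y - f x - l * (y - x)| <= e * `|y - x|.
  by apply: nbhs_dnbhs; exact: is_derive_taylor1.
apply: filterS2 (nbhs_dnbhs_neq x) => y yx h.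
have yx0 : y - x != 0 by rewrite subr_eq0.
rewrite distrC -(ler_pM2r (_ : 0 < `|y - x|)) ?normr_gt0//.
by rewrite -normrM mulrBl mulrAC mulVf// mul1r.
Qed.

Lemma is_derive_continuous (f df : R -> R) :
  (forall x : R, is_derive x (1 : R) f (df x)) -> continuous f.
Proof.
move=> dfx x; apply/differentiable_continuous/derivable1_diffP.
exact: ex_derive.
Qed.

(** The right Dini derivative of exp(- c t) g t is nonpositive. A norm along a
    differentiable curve has no derivative at its zeros, hence Dini
    derivatives. *)
Lemma dini_gronwall (g : R -> R) (c T : R) : 0 <= T ->
  {within `[0, T], continuous g} ->
  (forall t, 0 <= t < T -> forall e, 0 < e ->
     \forall s \near t^'+, g s - g t <= (s - t) * (c * g t + e)) ->
  g T <= expR (c * T) * g 0.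
Proof.
move=> T0 cg dini.
pose E t : R := expR (- c * t).
have dE (t : R) : is_derive t (1 : R) E (- c * E t).
  by rewrite /E; apply: is_derive_eq; rewrite /GRing.scale/= mulr1 mulrC.
have cE : continuous E := is_derive_continuous dE.
suff: E T * g T <= E 0 * g 0.
  rewrite /E mulr0 expR0 mul1r mulNr expRN => h.
  by rewrite -ler_pdivrMl ?expR_gt0.
apply: (@right_dini_le (fun t => E t * g t) idfun 0 T) => //.
- apply: within_continuousI => x xI; apply: cvgM; last exact: within_cvg.
  by apply: cvg_within_filter; exact: cE.
- by apply: continuous_subspaceT => x; exact: cvg_id.
move=> t tT e e0.
have Et : 0 < E t := expR_gt0 _.
(* Half of e is kept for the variation of E between t and s. *)
pose d := e / (2 * E t).
have d0 : 0 < d by rewrite divr_gt0// mulr_gt0.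
have slope : E s * (c * g t + d) + (s - t)^-1 * (E s - E t) * g t
    @[s --> t^'+] --> E t * (c * g t + d) + - c * E t * g t.
  apply: cvgD; apply: cvgM; try exact: cvg_cst.
    by apply: cvg_at_right_filter; exact: cE.
  by apply: cvg_dnbhs_at_right; exact: is_derive_slope.
have small : E t * (c * g t + d) + - c * E t * g t < e.
  have -> : E t * (c * g t + d) + - c * E t * g t = e / 2.
    by rewrite /d; field; rewrite gt_eqF.
  lra.
near=> s.
have ts : 0 < s - t by rewrite subr_gt0; near: s; exact: nbhs_right_gt.
have gs : g s - g t <= (s - t) * (c * g t + d) by near: s; exact: dini.
have : E s * (c * g t + d) + (s - t)^-1 * (E s - E t) * g t < e.
  near: s; exact: cvgr_lt slope _ small.
move=> /ltW; rewrite -(ler_pM2l ts) [e * _]mulrC /=; apply: le_trans.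
rewrite mulrDr !mulrA divff ?gt_eqF// mul1r.
have := ler_wpM2l (expR_ge0 (- c * s)) gs; rewrite -/(E s); lra.
Unshelve. all: by end_near. Qed.

End real_calculus.

(** * Absolutely continuous functions on the unit interval *)

Section primitives.
Context {R : realType}.
Notation mu := (@lebesgue_measure R).

Section real_valued_integrable.
Variable D : set (measurableTypeR R).
Hypothesis mD : measurable D.
Implicit Types f g : R -> R.

Lemma integrable_scaler c f : mu.-integrable D (EFin \o f) ->
  mu.-integrable D (EFin \o (fun u => c * f u)).
Proof.
move=> fi; rewrite (_ : _ \o _ = (fun u => c%:E * (f u)%:E)%E)//.
exact: integrableZl.
Qed.

Lemma integrable_addr f g : mu.-integrable D (EFin \o f) ->
  mu.-integrable D (EFin \o g) ->
  mu.-integrable D (EFin \o (fun u => f u + g u)).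
Proof.
move=> fi gi; rewrite (_ : _ \o _ = (fun u => (f u)%:E + (g u)%:E)%E)//.
exact: integrableD.
Qed.

Lemma integrable_subr f g : mu.-integrable D (EFin \o f) ->
  mu.-integrable D (EFin \o g) ->
  mu.-integrable D (EFin \o (fun u => f u - g u)).
Proof.
move=> fi gi; rewrite (_ : _ \o _ = (fun u => (f u)%:E - (g u)%:E)%E)//.
exact: integrableB.
Qed.

Lemma integrable_norm f : mu.-integrable D (EFin \o f) ->
  mu.-integrable D (EFin \o (fun u => `|f u|)).
Proof. by move=> fi; exact: (integrable_abse fi). Qed.

End real_valued_integrable.

(** The antiderivative is the signed integral from 0. Near any point it differs
    by a constant from an integral with a fixed lower bound further to the left,
    to which the fundamental theorem of calculus applies. *)
Lemma continuous_antiderivative (w : R -> R) : continuous w ->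
  exists W : R -> R, [/\ W 0 = 0, forall x : R, is_derive x 1 W (w x) &
    forall t, 0 <= t -> W t = \int[mu]_(u in `[0, t]) w u].
Proof.
move=> cw.
have iw (a b : R) : mu.-integrable `[a, b] (EFin \o w).
  apply: continuous_compact_integrable; first exact: segment_compact.
  exact: continuous_subspaceT.
have empty (a b : R) : b <= a -> \int[mu]_(u in `[a, b]) w u = 0.
  rewrite le_eqVlt => /predU1P[->|ba]; first by rewrite set_itv1 Rintegral_set1.
  by rewrite set_itv_ge ?Rintegral_set0// bnd_simp -ltNge.
have split3 (a b c : R) : a <= b -> b <= c ->
    \int[mu]_(u in `[a, c]) w u - \int[mu]_(u in `[a, b]) w u =
    \int[mu]_(u in `[b, c]) w u.
  move=> ab bc; rewrite Rintegral_itvB// Rintegral_itv_obnd_cbnd//.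
  by apply: integrableS (iw b c) => //; exact: subset_itv_oc_cc.
pose W t := \int[mu]_(u in `[0, t]) w u - \int[mu]_(u in `[t, 0]) w u.
have WE (N t : R) : N <= 0 -> N <= t ->
    W t = \int[mu]_(u in `[N, t]) w u - \int[mu]_(u in `[N, 0]) w u.
  move=> N0 Nt; rewrite /W; have [t0|/ltW t0] := leP 0 t.
    by rewrite (empty t 0)// subr0 split3.
  by rewrite (empty 0 t)// sub0r -(split3 N t 0)// opprB.
exists W; split.
- by rewrite /W subrr.
- move=> x; pose N := - (`|x| + 1).
  have N0 : N <= 0 by rewrite oppr_le0 addr_ge0.
  have Nx : N < x by rewrite ltrNl (le_lt_trans (ler_norm _))// normrN ltrDl.
  have x1 : x < x + 1 by rewrite ltrDl.
  have [dF F'] := continuous_FTC1_closed x1 (iw N (x + 1)) Nx (cw x).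
  have -> : w x = w x - 0 by rewrite subr0.
  apply: (@near_eq_is_derive _ _ _ (fun t => \int[mu]_(u in `[N, t]) w u -
      \int[mu]_(u in `[N, 0]) w u)).
    near=> t; apply/esym/WE => //; apply: ltW; near: t; exact: lt_nbhsr.
  apply: is_deriveB; by rewrite -F' derive1E; exact/derivableP.
- by move=> t t0; rewrite /W (empty t 0)// subr0.
Unshelve. all: by end_near. Qed.

(** This is absolute continuity on [0, 1], with an almost everywhere derivative
    given as data; it avoids any differentiation almost everywhere. *)
Definition is_primitive (f g : R -> R) :=
  mu.-integrable `[0, 1] (EFin \o g) /\
  forall u, 0 <= u <= 1 -> f u = f 0 + \int[mu]_(t in `[0, u]) g t.

Lemma sub_itv01 (a b : R) : 0 <= a -> b <= 1 ->
  `[a, b]%classic `<=` `[0, 1]%classic.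
Proof.
move=> a0 b1 u /=; rewrite !in_itv/= => /andP[au ub].
by rewrite (le_trans a0)//= (le_trans ub).
Qed.

Lemma integrable_sub_itv01 (F : R -> \bar R) (a b : R) : 0 <= a -> b <= 1 ->
  mu.-integrable `[0, 1] F -> mu.-integrable `[a, b] F.
Proof. by move=> a0 b1; apply: integrableS => //; exact: sub_itv01. Qed.

Lemma integrable_mul_within (a b : R) (g h : R -> R) :
  mu.-integrable `[a, b] (EFin \o g) -> {within `[a, b], continuous h} ->
  mu.-integrable `[a, b] (EFin \o (fun u => g u * h u)).
Proof.
move=> ig ch.
have mh : measurable_fun `[a, b]%classic h.
  by apply: subspace_continuous_measurable_fun.
have bh : [bounded h x | x in `[a, b]%classic].
  have /compact_bounded[M [_ mrt]] :=
    continuous_compact ch (@segment_compact R a b).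
  by exists M; split; rewrite ?num_real // => ? ? ? ?; exact: mrt.
rewrite (_ : _ \o _ = (EFin \o g) \* (EFin \o h))%E//.
exact: integrableMl.
Qed.

Lemma is_primitiveB f g a b : is_primitive f g -> 0 <= a -> a <= b -> b <= 1 ->
  f b - f a = \int[mu]_(t in `[a, b]) g t.
Proof.
move=> [ig fE] a0 ab b1; rewrite (fE a) ?a0 ?(le_trans ab)//.
rewrite (fE b) ?b1 ?(le_trans a0)// opprD addrACA subrr add0r.
rewrite Rintegral_itvB ?bnd_simp//; last exact: integrable_sub_itv01.
rewrite Rintegral_itv_obnd_cbnd//.
apply: integrableS (integrable_sub_itv01 a0 b1 ig) => //.
exact: subset_itv_oc_cc.
Qed.

Lemma is_primitive_Rintegral g : mu.-integrable `[0, 1] (EFin \o g) ->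
  is_primitive (fun u => \int[mu]_(t in `[0, u]) g t) g.
Proof. by move=> ig; split=> // u _; rewrite set_itv1 Rintegral_set1 add0r. Qed.

Lemma is_primitive_continuous f g :
  is_primitive f g -> {within `[0, 1], continuous f}.
Proof.
move=> [ig fE]; have c := parameterized_integral_continuous ler01 ig.
apply: within_continuousI => x xI; have := xI; rewrite /= in_itv/= => x01.
rewrite [X in _ --> X](fE x x01).
have : f 0 + \int[mu]_(t in `[0, y]) g t @[y --> within `[0, 1] (nbhs x)] -->
    f 0 + \int[mu]_(t in `[0, x]) g t.
  by apply: cvgD; [exact: cvg_cst|exact: within_cvg c xI].
apply: cvg_trans; apply: near_eq_cvg.
by rewrite near_withinE; near=> y; rewrite /= in_itv/= => /fE ->.
Unshelve. all: by end_near. Qed.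

Lemma Rintegral_norm_mul_le (g k : R -> R) (a b e : R) :
  mu.-integrable `[a, b] (EFin \o g) ->
  mu.-integrable `[a, b] (EFin \o (fun u => g u * k u)) ->
  (forall u, a <= u <= b -> `|k u| <= e) ->
  `|\int[mu]_(t in `[a, b]) (g t * k t)| <=
  e * \int[mu]_(t in `[a, b]) `|g t|.
Proof.
move=> ig igk ke; apply: le_trans (le_normr_Rintegral _ igk) _ => //.
rewrite -RintegralZl//; last exact: integrable_norm.
apply: le_Rintegral => //; first exact: integrable_norm.
  by apply: integrable_scaler => //; exact: integrable_norm.
by move=> u /=; rewrite in_itv/= => /ke kue; rewrite normrM mulrC ler_wpM2r.
Qed.

Lemma is_primitive_lin (c : R) f1 f2 g1 g2 :
  is_primitive f1 g1 -> is_primitive f2 g2 ->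
  is_primitive (fun u => c * f1 u + f2 u) (fun u => c * g1 u + g2 u).
Proof.
move=> [ig1 fE1] [ig2 fE2].
have icg1 := integrable_scaler (measurable_itv _) c ig1.
split; first exact: integrable_addr.
move=> u uI; have /andP[u0 u1] := uI.
rewrite RintegralD//; [|exact: integrable_sub_itv01..].
rewrite RintegralZl//; last exact: integrable_sub_itv01.
by rewrite (fE1 u uI) (fE2 u uI); ring.
Qed.

Lemma is_primitive0 : is_primitive (fun=> 0) (fun=> 0).
Proof.
split; first exact: (@integrable0 _ _ _ mu).
by move=> u _; rewrite /Rintegral integral0 add0r.
Qed.

Lemma eq_is_primitive f f' g g' :
  (forall u, 0 <= u <= 1 -> f u = f' u) ->
  (forall u, 0 <= u <= 1 -> g u = g' u) ->
  is_primitive f g -> is_primitive f' g'.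
Proof.
move=> ff' gg' [ig fE]; split.
  apply: eq_integrable ig => // u /set_mem/=; rewrite in_itv/= => uI.
  by rewrite gg'.
move=> u uI; rewrite -(ff' u uI) -(ff' 0) ?lexx ?ler01// (fE u uI).
congr (_ + _).
apply: eq_Rintegral => t /set_mem/=; rewrite in_itv/= => /andP[t0 tu].
by rewrite gg'// t0 (le_trans tu)//; case/andP: uI.
Qed.

(** Chain rule. For s just after t, both the increment of Phi \o f and the
    integral of g phi(f) over [t, s] differ from phi(f t) (f s - f t) by at most
    e times the integral of |g| over [t, s]. So the Dini derivatives of their
    difference vanish relative to the primitive of |g|. *)
Lemma is_primitive_comp (Phi phi f g : R -> R) :
  (forall x : R, is_derive x 1 Phi (phi x)) -> continuous phi ->
  is_primitive f g -> is_primitive (Phi \o f) (fun u => g u * phi (f u)).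
Proof.
move=> dPhi cphi pfg; have [ig fE] := pfg.
have cf := is_primitive_continuous pfg.
have cphif : {within `[0, 1], continuous (phi \o f)}.
  exact: continuous_comp_within.
have igp := integrable_mul_within ig cphif.
split => // v /andP[v0 v1].
have pk := is_primitive_Rintegral igp; have ck := is_primitive_continuous pk.
have pM := is_primitive_Rintegral (integrable_norm ig).
have cM := is_primitive_continuous pM.
pose k u := \int[mu]_(t in `[0, u]) (g t * phi (f t)).
(* The factor 2 pays for the two errors of size e. *)
pose M u := 2 * \int[mu]_(t in `[0, u]) `|g t|.
have k0 : k 0 = 0 by rewrite /k set_itv1 Rintegral_set1.
have cPf : {within `[0, 1], continuous (Phi \o f)}.
  exact: continuous_comp_within (is_derive_continuous dPhi) cf.
have sub : `[0, v]%classic `<=` `[0, 1]%classic by exact: sub_itv01.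
pose h u := Phi (f u) - k u.
have ch : {within `[0, v], continuous h}.
  apply: (continuous_subspaceW sub); apply: within_continuousI => x xI.
  by apply: cvgB; [exact: within_cvg cPf xI|exact: within_cvg ck xI].
have cM' : {within `[0, v], continuous M}.
  apply: (continuous_subspaceW sub); apply: within_continuousI => x xI.
  by apply: cvgM; [exact: cvg_cst|exact: within_cvg cM xI].
have key t : 0 <= t < v -> forall e, 0 < e ->
    \forall s \near t^'+, `|h s - h t| <= e * (M s - M t).
  move=> /andP[t0 tv] e e0.
  have t1 : t < 1 by exact: lt_le_trans v1.
  have tI : `[0, 1]%classic t by rewrite /= in_itv/= t0 ltW.
  (* The estimates are needed for all points between t and s at once. *)
  have rightW (P : set R) : (\forall s \near within `[0, 1] (nbhs t), P s) ->
      \forall s \near t^'+, forall r, t <= r <= s -> P r.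
    rewrite near_withinE => -[d /= d0 dP].
    near=> s => r /andP[tr rs]; apply: dP => /=.
      rewrite distrC ger0_norm ?subr_ge0// (@le_lt_trans _ _ (s - t))//.
        by rewrite lerD2r.
      by rewrite ltrBlDl; near: s; apply: nbhs_right_lt; rewrite ltrDl.
    rewrite in_itv/= (le_trans t0)//= (le_trans rs)//.
    near: s; exact: nbhs_right_le.
  have taylor : \forall s \near t^'+, forall r, t <= r <= s ->
      `|Phi (f r) - Phi (f t) - phi (f t) * (f r - f t)| <= e * `|f r - f t|.
    apply: rightW.
    exact: (within_cvg cf tI (is_derive_taylor1 (dPhi (f t)) e0)).
  have phicont : \forall s \near t^'+, forall r, t <= r <= s ->
      `|phi (f t) - phi (f r)| <= e.
    apply: rightW.
    by have /cvgrPdist_le/(_ _ e0) := within_cvg cphif tI.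
  near=> s.
  have ts : t < s by near: s; exact: nbhs_right_gt.
  have s1 : s <= 1 by near: s; exact: nbhs_right_le.
  have igs := integrable_sub_itv01 t0 s1 ig.
  have igps := integrable_sub_itv01 t0 s1 igp.
  have fs := is_primitiveB pfg t0 (ltW ts) s1.
  have ks := is_primitiveB pk t0 (ltW ts) s1.
  have Ms := is_primitiveB pM t0 (ltW ts) s1.
  have fle : `|f s - f t| <= \int[mu]_(r in `[t, s]) `|g r|.
    by rewrite fs; exact: le_normr_Rintegral.
  have T : `|Phi (f s) - Phi (f t) - phi (f t) * (f s - f t)| <=
      e * \int[mu]_(r in `[t, s]) `|g r|.
    apply: (@le_trans _ _ (e * `|f s - f t|)); last by rewrite ler_pM2l.
    have : forall r, t <= r <= s ->
      `|Phi (f r) - Phi (f t) - phi (f t) * (f r - f t)| <= e * `|f r - f t|.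
      by near: s.
    by apply; rewrite lexx ltW.
  have igd : mu.-integrable `[t, s]
      (EFin \o (fun r => g r * (phi (f t) - phi (f r)))).
    apply: integrable_mul_within => //.
    apply: (continuous_subspaceW (sub_itv01 t0 s1)).
    apply: within_continuousI => x xI.
    by apply: cvgB; [exact: cvg_cst|exact: within_cvg cphif xI].
  have P : `|phi (f t) * (f s - f t) - (k s - k t)| <=
      e * \int[mu]_(r in `[t, s]) `|g r|.
    rewrite fs ks -RintegralZl// -RintegralB//; last exact: integrable_scaler.
    under eq_Rintegral do rewrite mulrC -mulrBr.
    apply: Rintegral_norm_mul_le => // u uI.
    have : forall r, t <= r <= s -> `|phi (f t) - phi (f r)| <= e by near: s.
    by apply.
  rewrite /M -mulrBr Ms mulrA [e * 2]mulrC -mulrA mulrDl mul1r.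
  apply: le_trans (lerD T P); apply: le_trans (ler_normD _ _).
  by rewrite /h le_eqVlt; apply/predU1P; left; congr `|_|; ring.
have vI : 0 <= v <= v by rewrite v0 lexx.
have le1 : h v <= h 0.
  apply: (right_dini_le v0 ch cM') => t tv e e0.
  by apply: filterS (key t tv e e0) => s; apply: le_trans (ler_norm _).
have le2 : - h v <= - h 0.
  apply: (@right_dini_le _ (fun u => - h u) M) => //.
    by apply: within_continuousI => x xI; apply: cvgN; exact: within_cvg ch xI.
  move=> t tv e e0; apply: filterS (key t tv e e0) => s; apply: le_trans.
  by rewrite -opprD ler_normr lexx orbT.
have : h v = h 0 by apply/le_anti; rewrite le1/= -lerN2.
by rewrite /h k0 subr0 => /eqP; rewrite subr_eq => /eqP.
Unshelve. all: by end_near. Qed.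

End primitives.

(** * Weak derivatives and primitives *)

Section weak_derivatives.
Context {R : realType}.
Notation mu := (@lebesgue_measure R).

Lemma Rintegral_cst_itv (c u : R) : 0 <= u -> \int[mu]_(_ in `[0, u]) c = c * u.
Proof.
move=> u0; rewrite Rintegral_cst//= lebesgue_measure_itv/= lte_fin.
by case: ltgtP u0 => //= [u0 _|<- _]; rewrite ?subr0 ?mulr0.
Qed.

Lemma is_primitive_id : is_primitive (@idfun R) (fun=> 1).
Proof.
split; first by apply: integrable_continuous => x; exact: cvg_cst.
by move=> u /andP[u0 _]; rewrite Rintegral_cst_itv// mul1r add0r.
Qed.

Lemma is_primitive_C1 (Phi phi : R -> R) :
  (forall x : R, is_derive x 1 Phi (phi x)) -> continuous phi ->
  is_primitive Phi phi.
Proof.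
move=> dPhi cphi; have := is_primitive_comp dPhi cphi is_primitive_id.
by apply: eq_is_primitive => // u _; rewrite mul1r.
Qed.

(** By polarization, 4 f1 f2 = (f1 + f2)^2 - (f2 - f1)^2, the product rule
    reduces to the chain rule for the square. *)
Lemma is_primitive_mul (f1 f2 g1 g2 : R -> R) :
  is_primitive f1 g1 -> is_primitive f2 g2 ->
  is_primitive (fun u => f1 u * f2 u) (fun u => g1 u * f2 u + g2 u * f1 u).
Proof.
move=> p1 p2.
have dsq (x : R) : is_derive x 1 (fun y : R => y ^+ 2) (2 * x).
  by apply: is_derive_eq; rewrite /GRing.scale/=; ring.
have csq : continuous (fun y : R => 2 * y).
  by move=> x; apply: cvgM; [exact: cvg_cst|exact: cvg_id].
have ps := is_primitive_comp dsq csq (is_primitive_lin 1 p1 p2).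
have pd := is_primitive_comp dsq csq (is_primitive_lin (-1) p1 p2).
have := is_primitive_lin 4^-1 (is_primitive_lin (-1) pd ps) is_primitive0.
by apply: eq_is_primitive => u _ /=; field.
Qed.

Lemma test_fun_is_derive (phi : R -> R) : test_fun phi ->
  forall x : R, is_derive x 1 phi (derive1 phi x).
Proof. by move=> [_ dphi _] x; rewrite derive1E; exact/derivableP. Qed.

Lemma test_fun01 (phi : R -> R) : test_fun phi -> phi 1 = phi 0.
Proof. by move=> [per _ _]; rewrite -[1]add0r per. Qed.

Lemma is_primitive_weak (f g phi : R -> R) : is_primitive f g -> f 1 = f 0 ->
  test_fun phi ->
  \int[mu]_(u in `[0, 1]) (f u * derive1 phi u) =
  - \int[mu]_(u in `[0, 1]) (g u * phi u).
Proof.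
move=> pfg f10 tphi; have [_ _ cdphi] := tphi.
have pphi := is_primitive_C1 (test_fun_is_derive tphi) cdphi.
have [_ /(_ 1)] := is_primitive_mul pfg pphi.
rewrite ler01 lexx => /(_ isT).
rewrite f10 (test_fun01 tphi) RintegralD//.
- move=> /eqP; rewrite eq_sym -subr_eq0 addrAC subrr add0r addrC addr_eq0.
  by move=> /eqP <-; apply: eq_Rintegral => u _; rewrite mulrC.
- apply: integrable_mul_continuous; first exact: pfg.1.
  exact: test_fun_continuous.
- apply: integrable_mul_within; last exact: is_primitive_continuous pfg.
  exact: pphi.1.
Qed.

Lemma test_fun_cst (c : R) : test_fun (cst c).
Proof.
split=> [//|u|]; first exact: derivable_cst.
rewrite (_ : derive1 _ = cst 0); first by move=> x; exact: cvg_cst.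
by apply/funext => x; rewrite derive1_cst.
Qed.

Lemma within_continuous_Rintegral_eq0 (q : R -> R) :
  {within `[0, 1], continuous q} ->
  (forall b : R, 0 < b -> b <= 1 -> \int[mu]_(u in `[0, b]) q u = 0) ->
  forall u, 0 <= u <= 1 -> q u = 0.
Proof.
move=> cq q0.
have iq : mu.-integrable `[0, 1] (EFin \o q).
  by apply: continuous_compact_integrable => //; exact: segment_compact.
have [cqo q0r q1l] := (continuous_within_itvP q (@ltr01 R)).1 cq.
have qo (x : R) : 0 < x -> x < 1 -> q x = 0.
  move=> x0 x1.
  have cx : {for x, continuous q} by apply: cqo; rewrite in_itv/= x0.
  have [_ <-] := continuous_FTC1_closed x1 iq x0 cx.
  rewrite derive1E (@near_eq_derive _ _ _ _ (cst 0)) ?derive_cst//.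
  near=> y; apply: q0; last by apply: ltW; near: y; exact: lt_nbhsl.
  by near: y; exact: lt_nbhsr.
move=> u /andP[]; rewrite le_eqVlt => /predU1P[<- _|u0].
  apply: (cvg_unique _ q0r); first exact: Rhausdorff.
  apply: (@cvg_trans _ (0 @[u --> (0:R)^'+])); last exact: cvg_cst.
  by apply: near_eq_cvg; near=> y; rewrite qo.
rewrite le_eqVlt => /predU1P[->|]; last exact: qo.
apply: (cvg_unique _ q1l); first exact: Rhausdorff.
apply: (@cvg_trans _ (0 @[u --> (1:R)^'-])); last exact: cvg_cst.
by apply: near_eq_cvg; near=> y; rewrite qo.
Unshelve. all: by end_near. Qed.

(** An antiderivative is periodic because its increment over one period is
    constant, hence equal to the integral over [0, 1], which is 0. *)
Lemma test_fun_antiderivative (psi : R -> R) : test_fun psi ->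
  exists2 phi, test_fun phi & forall u : R,
    derive1 phi u = psi u - \int[mu]_(v in `[0, 1]) psi v.
Proof.
move=> tpsi; have cpsi := test_fun_continuous tpsi.
set m := \int[mu]_(v in _) _.
have cpm : continuous (fun u => psi u - m).
  by move=> x; apply: cvgB; [exact: cpsi|exact: cvg_cst].
have [phi [phi0 dphi phiE]] := continuous_antiderivative cpm.
have dphiE : derive1 phi = (fun u => psi u - m).
  by apply/funext => u; rewrite derive1E; have [_ ->] := dphi u.
exists phi; last by move=> u; rewrite dphiE.
split; last by rewrite dphiE.
  move=> u; apply/eqP; rewrite -subr_eq0; apply/eqP.
  have -> : 0 = phi (0 + 1) - phi 0.
    rewrite add0r phi0 subr0 phiE// RintegralB//; last 2 first.
    - exact: integrable_continuous.
    - by apply: integrable_continuous => x; exact: cvg_cst.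
    by rewrite Rintegral_cst_itv// mulr1 subrr.
  apply: (@is_derive_0_is_cst _ (fun v => phi (v + 1) - phi v)) => x.
  have per : psi (x + 1) = psi x by have [] := tpsi.
  have d1 : is_derive x (1 : R) (fun v => phi (v + 1)) (psi x - m).
    rewrite -per -[psi (x + 1) - m]mulr1.
    apply: (@is_derive1_comp _ phi (fun v => v + 1)).
    by apply: is_derive_eq; rewrite addr0.
  by apply: is_derive_eq; rewrite subrr.
by move=> u; have [] := dphi u.
Qed.

(** Lemma of du Bois-Reymond. The function k = \int_0 g has the same weak
    derivative as f, so f - k is orthogonal to all derivatives of test
    functions, that is, to all test functions of mean 0. Hence f - k minus its
    mean m is orthogonal to all test functions, and vanishes. *)
Lemma weak_is_primitive (f g : R -> R) : continuous f -> f 1 = f 0 ->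
  mu.-integrable `[0, 1] (EFin \o g) ->
  (forall phi, test_fun phi ->
     \int[mu]_(u in `[0, 1]) (f u * derive1 phi u) =
     - \int[mu]_(u in `[0, 1]) (g u * phi u)) ->
  is_primitive f g.
Proof.
move=> cf f10 ig weak.
pose k u := \int[mu]_(t in `[0, u]) g t.
have pk : is_primitive k g := is_primitive_Rintegral ig.
have k0 : k 0 = 0 by rewrite /k set_itv1 Rintegral_set1.
have k1 : k 1 = 0.
  have := weak _ (test_fun_cst 1).
  rewrite (_ : derive1 _ = cst 0); last first.
    by apply/funext => x; rewrite derive1_cst.
  under eq_Rintegral do rewrite mulr0.
  under [in RHS]eq_Rintegral do rewrite mulr1.
  by rewrite Rintegral_cst_itv// mul0r => /esym/eqP; rewrite oppr_eq0 => /eqP.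
have cd : {within `[0, 1], continuous (fun u => f u - k u)}.
  apply: within_continuousI => x xI; apply: cvgB.
    by apply: cvg_within_filter; exact: cf.
  exact: within_cvg (is_primitive_continuous pk) xI.
have ifk : mu.-integrable `[0, 1] (EFin \o (fun u => f u - k u)).
  by apply: continuous_compact_integrable => //; exact: segment_compact.
pose m := \int[mu]_(u in `[0, 1]) (f u - k u).
have ort (psi : R -> R) : test_fun psi ->
    \int[mu]_(u in `[0, 1]) (((f u - k u) - m) * psi u) = 0.
  move=> tpsi; have [phi tphi dphi] := test_fun_antiderivative tpsi.
  have cpsi := test_fun_continuous tpsi.
  set c := \int[mu]_(v in _) psi v in dphi.
  have [_ _ cdphi] := tphi.
  have w1 := weak _ tphi.
  have w2 := is_primitive_weak pk (etrans k1 (esym k0)) tphi.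
  have : \int[mu]_(u in `[0, 1]) (derive1 phi u * (f u - k u)) = 0.
    under eq_Rintegral do rewrite mulrBr [_ * f _]mulrC [_ * k _]mulrC.
    rewrite RintegralB ?w1 ?w2 ?subrr//.
      by apply: integrable_mul_continuous => //; exact: integrable_continuous.
    apply: integrable_mul_continuous => //.
    apply: continuous_compact_integrable; first exact: segment_compact.
    exact: is_primitive_continuous pk.
  move=> e0.
  transitivity (\int[mu]_(u in `[0, 1])
      (derive1 phi u * (f u - k u) +
        (c * (f u - k u) - m * psi u))).
    by apply: eq_Rintegral => u _; rewrite dphi; ring.
  have icd : mu.-integrable `[0, 1] (EFin \o (fun u => c * (f u - k u))).
    by exact: integrable_scaler.
  have imp : mu.-integrable `[0, 1] (EFin \o (fun u => m * psi u)).
    by apply: integrable_scaler => //; exact: integrable_continuous.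
  have idf : mu.-integrable `[0, 1]
      (EFin \o (fun u => derive1 phi u * (f u - k u))).
    by apply: (integrable_mul_within _ cd); exact: integrable_continuous.
  rewrite RintegralD//; last exact: integrable_subr.
  rewrite e0 add0r RintegralB// RintegralZl//.
  rewrite RintegralZl//; last exact: integrable_continuous.
  by rewrite -/m -/c mulrC subrr.
have cdm : {within `[0, 1], continuous (fun u => (f u - k u) - m)}.
  apply: within_continuousI => x xI; apply: cvgB; last exact: cvg_cst.
  exact: within_cvg cd xI.
have idm : mu.-integrable `[0, 1] (EFin \o (fun u => (f u - k u) - m)).
  by apply: continuous_compact_integrable => //; exact: segment_compact.
have q0 := within_continuous_Rintegral_eq0 cdm (integral_test_fun_eq0 idm ort).
split=> // u uI.
have := q0 u uI; have := q0 0; rewrite lexx ler01 => /(_ isT).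
by rewrite k0 -/(k u); lra.
Qed.

End weak_derivatives.

(** * The kernel on the circle *)

Section circle_kernel.
Context {R : realType}.

Lemma bounded_derive_lipschitz (f df : R -> R) (l a b : R) :
  (forall x, a <= x <= b -> is_derive x 1 f (df x)) ->
  (forall x, a <= x <= b -> `|df x| <= l) ->
  forall x y, a <= x <= b -> a <= y <= b -> `|f x - f y| <= l * `|x - y|.
Proof.
move=> dfx dfl x y; wlog xy : x y / x <= y => [wlg|].
  case: (leP x y) => [|/ltW] xy xI yI; first exact: wlg.
  by rewrite distrC [`|x - y|]distrC; exact: wlg.
move=> /andP[ax xb] /andP[ay yb].
have inI z : z \in `[x, y]%R -> a <= z <= b.
  by rewrite in_itv/= => /andP[xz zy]; rewrite (le_trans ax)//= (le_trans zy).
have [||z zI e] := @MVT_segment _ f df x y xy.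
- move=> z zI; apply/dfx/inI; move: zI; rewrite !in_itv/=.
  by move=> /andP[/ltW-> /ltW->].
- apply: derivable_within_continuous => z /inI/dfx dz; exact: ex_derive.
rewrite distrC e normrM [X in _ * X]distrC.
by apply: ler_wpM2r => //; apply/dfl/inI.
Qed.

Lemma bounded_derive_lipschitzT (f df : R -> R) (l : R) :
  (forall x : R, is_derive x 1 f (df x)) -> (forall x, `|df x| <= l) ->
  forall x y, `|f x - f y| <= l * `|x - y|.
Proof.
move=> dfx dfl x y.
apply: (@bounded_derive_lipschitz _ df l (Num.min x y) (Num.max x y)) => //.
- by rewrite ge_min le_max lexx.
- by rewrite ge_min le_max lexx !orbT.
Qed.

Lemma within_continuous_bounded (f : R -> R) (a b : R) :
  {within `[a, b], continuous f} ->
  exists2 l : R, 0 <= l & forall x, a <= x <= b -> `|f x| <= l.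
Proof.
move=> cf.
have /compact_bounded[M [_ fM]] :=
  continuous_compact cf (@segment_compact R a b).
exists (`|M| + 1); first by rewrite addr_ge0.
move=> x xI; apply: (fM (`|M| + 1)); first by rewrite ltr_pwDr// ler_norm.
by exists x => //=; rewrite in_itv/=.
Qed.

Lemma C1_lipschitz (f df : R -> R) (a b : R) :
  (forall x, a <= x <= b -> is_derive x 1 f (df x)) ->
  {within `[a, b], continuous df} ->
  exists2 l : R, 0 <= l & forall x y, a <= x <= b -> a <= y <= b ->
    `|f x - f y| <= l * `|x - y|.
Proof.
move=> dfx /within_continuous_bounded[l l0 dfl].
by exists l => //; exact: bounded_derive_lipschitz dfx dfl.
Qed.

Lemma lipschitz_continuous (f : R -> R) (l : R) :
  (forall x y, `|f x - f y| <= l * `|x - y|) -> continuous f.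
Proof.
move=> fl x; apply/cvgrPdist_le => e e0; near=> y.
have l1 : 0 < `|l| + 1 by rewrite ltr_pwDr.
apply: le_trans (fl x y) _.
apply: (@le_trans _ _ ((`|l| + 1) * `|x - y|)).
  by apply: ler_wpM2r => //; rewrite ler_wpDr// ler_norm.
rewrite mulrC -ler_pdivlMr//; near: y.
have := @cvg_id _ (nbhs x); move/cvgrPdist_le; apply.
by rewrite divr_gt0.
Unshelve. all: by end_near. Qed.

(** One period of the kernel, as a smooth function on the whole line. *)
Definition profile (lambda : R) (y : R) : R :=
  - cosh ((y - 1 / 2) / lambda) / (2 * lambda * sinh (1 / (2 * lambda))).

Lemma circle_kernelE (lambda x : R) :
  circle_kernel lambda x = profile lambda (x - (Num.floor x)%:~R).
Proof.
by rewrite /circle_kernel/= /profile ger0_norm// subr_ge0 floor_le.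
Qed.

Lemma profile01 (lambda : R) : profile lambda 0 = profile lambda 1.
Proof.
rewrite /profile /cosh; congr (- (_ / _) / _).
rewrite [LHS]addrC; congr (expR _ + expR _).
  by rewrite -[LHS]mulNr; congr (_ / _); lra.
by rewrite -[RHS]mulNr; congr (_ / _); lra.
Qed.

Lemma profile_lipschitz (lambda : R) : exists2 l : R, 0 <= l &
  forall x y, 0 <= x <= 1 -> 0 <= y <= 1 ->
    `|profile lambda x - profile lambda y| <= l * `|x - y|.
Proof.
pose c := (2 * lambda * sinh (1 / (2 * lambda)))^-1.
have dP (x : R) : is_derive x 1 (profile lambda)
    (- sinh ((x - 1 / 2) / lambda) / lambda * c).
  have d1 : is_derive x (1 : R) (fun y => (y - 1 / 2) / lambda) lambda^-1.
    by apply: is_derive_eq; rewrite /GRing.scale/=; ring.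
  rewrite /profile /cosh /sinh.
  apply: is_derive_eq; rewrite -/c /GRing.scale/=; ring.
apply: (C1_lipschitz (fun x _ => dP x)).
by apply: continuous_subspaceT; apply: is_derive_continuous.
Qed.

Lemma floor_sub01 (x : R) : 0 <= x - (Num.floor x)%:~R <= 1.
Proof.
rewrite subr_ge0 floor_le/= lerBlDl ltW//.
by rewrite -[X in _ + X]/(1%:~R) -intrD floorD1_gt.
Qed.

(** The profile is Lipschitz on [0, 1] and has equal values at both ends; when
    two points lie in different periods, their values are compared through these
    end values, at a cost that does not exceed the distance. *)
Lemma circle_kernel_lipschitz (lambda : R) : exists2 l : R, 0 <= l &
  forall x y,
    `|circle_kernel lambda x - circle_kernel lambda y| <= l * `|x - y|.
Proof.
have [l l0 pl] := profile_lipschitz lambda; exists l => // x y.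
wlog xy : x y / x <= y => [wlg|].
  case: (leP x y) => [|/ltW] xy; first exact: wlg.
  by rewrite distrC [`|x - y|]distrC; exact: wlg.
rewrite !circle_kernelE; have xI := floor_sub01 x; have yI := floor_sub01 y.
have := le_floor xy; rewrite le_eqVlt => /predU1P[exy|fxy].
  apply: le_trans (pl _ _ xI yI) _; rewrite exy.
  by rewrite opprB addrA subrK.
have {}fxy : (Num.floor x)%:~R + 1 <= (Num.floor y)%:~R :> R.
  by rewrite -[X in _ + X]/(1%:~R) -intrD ler_int lezD1.
rewrite (_ : profile lambda _ - _ =
    (profile lambda (x - (Num.floor x)%:~R) - profile lambda 1) +
    (profile lambda 0 - profile lambda (y - (Num.floor y)%:~R))); last first.
  by rewrite profile01 addrA subrK.
apply: le_trans (ler_normD _ _) _.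
have I1 : 0 <= (1 : R) <= 1 by rewrite ler01 lexx.
have I0 : 0 <= (0 : R) <= 1 by rewrite ler01 lexx.
apply: le_trans (lerD (pl _ _ xI I1) (pl _ _ I0 yI)) _.
rewrite -mulrDr; apply: ler_wpM2l => //.
rewrite [`|x - y|]ler0_norm ?subr_le0//.
rewrite ler0_norm; last by case/andP: xI; lra.
rewrite ler0_norm; last by case/andP: yI; lra.
lra.
Qed.

Lemma circle_kernel_periodic (lambda : R) : periodic (circle_kernel lambda) 1.
Proof.
move=> x; rewrite !circle_kernelE floorDrz ?rpred1// floor1 intrD.
congr profile.
by rewrite opprD addrACA subrr addr0.
Qed.

Lemma circle_kernel_bounded (lambda : R) : exists2 B : R, 0 <= B &
  forall x, `|circle_kernel lambda x| <= B.
Proof.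
have [l l0 pl] := profile_lipschitz lambda.
exists (`|profile lambda 0| + l); first by rewrite addr_ge0.
move=> x; rewrite circle_kernelE; have xI := floor_sub01 x.
have I0 : 0 <= (0 : R) <= 1 by rewrite ler01 lexx.
rewrite -[X in `|X|](subrK (profile lambda 0)) addrC.
apply: le_trans (ler_normD _ _) _; rewrite lerD2l.
apply: le_trans (pl _ _ xI I0) _; rewrite ler_piMr// subr0 ger0_norm.
  by case/andP: xI.
by case/andP: xI.
Qed.

(** Each turn around the circle adds K 1, the mean of the kernel. Unlike the
    kernel, whose derivative jumps at the integers, K is differentiable with a
    Lipschitz derivative. *)
Lemma circle_kernel_antiderivative (lambda : R) : exists K : R -> R,
  [/\ forall x : R, is_derive x 1 K (circle_kernel lambda x), K 0 = 0 &
      forall x, K (x + 1) = K x + K 1].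
Proof.
have [l _ /lipschitz_continuous cG] := circle_kernel_lipschitz lambda.
have [K [K0 dK _]] := continuous_antiderivative cG.
exists K; split=> // x.
suff : K (x + 1) - K x = K (0 + 1) - K 0.
  by rewrite add0r K0 subr0; lra.
apply: (@is_derive_0_is_cst _ (fun v => K (v + 1) - K v)) => v.
have d1 : is_derive v (1 : R) (fun v => K (v + 1)) (circle_kernel lambda v).
  rewrite -circle_kernel_periodic -[circle_kernel _ _]mulr1.
  apply: (@is_derive1_comp _ K (fun v => v + 1)).
  by apply: is_derive_eq; rewrite addr0.
by apply: is_derive_eq; rewrite subrr.
Qed.

End circle_kernel.

(** * Length and pointwise values of closed curves *)

Section curve_calculus.
Context {R : realType}.
Notation mu := (@lebesgue_measure R).
Local Notation I01 := (`[0, 1]%classic : set (measurableTypeR R)).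
Implicit Types (gamma f g : W11 R) (i : 'I_2).

Lemma ord2_eq0_or_eq1 i : i = 0 \/ i = 1.
Proof. by case: i => -[|[|//]] ?; [left|right]; exact/val_inj. Qed.

Lemma coord_le_enorm (v : 'rV[R]_2) i : `|v 0 i| <= enorm v.
Proof.
rewrite -(@ler_pXn2r _ 2)// ?nnegrE ?enorm_ge0// enorm_sqr.
rewrite real_normK ?num_real//.
have [->|->] := ord2_eq0_or_eq1 i.
- by rewrite lerDl sqr_ge0.
- by rewrite lerDr sqr_ge0.
Qed.

Lemma enormN (v : 'rV[R]_2) : enorm (- v) = enorm v.
Proof. by rewrite -scaleN1r enormZ normrN1 mul1r. Qed.

Lemma ler_enormB_dist (v w : 'rV[R]_2) : `|enorm v - enorm w| <= enorm (v - w).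
Proof.
rewrite ler_norml; apply/andP; split.
  rewrite lerNl opprB lerBlDr -[enorm (v - w)]enormN opprB.
  by rewrite -{1}(subrK v w) ler_enormD.
by rewrite lerBlDr -{1}(subrK w v) ler_enormD.
Qed.

Lemma W11_at1 f : f 1 = f 0.
Proof. by have := @W11_periodic _ f 0; rewrite add0r. Qed.

Lemma is_primitive_W11 f i :
  is_primitive (fun u => f u 0 i) (fun u => wderiv f u 0 i).
Proof.
have [ig weak] := wderivP f i.
apply: weak_is_primitive => //.
  exact/continuous_coord/W11_continuous.
by rewrite W11_at1.
Qed.

Lemma curve_length_ge0 f : 0 <= curve_length f.
Proof. by apply: Rintegral_ge0 => u _; exact: enorm_ge0. Qed.

Lemma curve_length_le_norm f : curve_length f <= W11_norm f.
Proof. by rewrite lerDr; apply: Rintegral_ge0 => u _; exact: enorm_ge0. Qed.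

Lemma ae_curve_length f (g : R -> 'rV[R]_2) :
  {ae mu, forall u, `[0, 1]%classic u -> wderiv f u = g u} ->
  (forall i, measurable_fun I01 (fun u => g u 0 i)) ->
  curve_length f = \int[mu]_(u in `[0, 1]) enorm (g u).
Proof.
move=> fg mg; congr fine; apply: ae_eq_integral => //.
- exact: measurable_int (integrable_enorm_wderiv _).
- apply/measurable_EFinP; exact: measurable_enorm.
- apply: filterS fg; first exact: (ae_filter_ringOfSetsType mu).
  by move=> u + uI => /(_ uI) ->.
Qed.

Lemma ler_curve_lengthD f g :
  curve_length (f + g) <= curve_length f + curve_length g.
Proof.
rewrite /curve_length -[f in leLHS]scale1r enorm_wderiv_linE.
rewrite -RintegralD//; [|exact: integrable_enorm_wderiv..].
apply: le_Rintegral => //.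
- apply: integrable_enorm => // i.
  rewrite (_ : _ \o _ = EFin \o (fun u => wderiv f u 0 i + wderiv g u 0 i));
    last by apply/funext => u /=; rewrite scale1r !mxE.
  by apply: integrable_addr => //; exact: integrable_wderiv_coord.
- by apply: integrable_addr => //; exact: integrable_enorm_wderiv.
- by move=> u _; rewrite scale1r; exact: ler_enormD.
Qed.

Lemma curve_lengthZ (a : R) f : curve_length (a *: f) = `|a| * curve_length f.
Proof.
have -> : a *: f = (a - 1) *: f + f by rewrite scalerBl scale1r subrK.
rewrite /curve_length enorm_wderiv_linE.
rewrite -RintegralZl//; last exact: integrable_enorm_wderiv.
by apply: eq_Rintegral => u _; rewrite scalerBl scale1r subrK enormZ.
Qed.

Lemma curve_lengthB_sym f g : curve_length (f - g) = curve_length (g - f).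
Proof. by rewrite -opprB -scaleN1r curve_lengthZ normrN1 mul1r. Qed.

Lemma ler_curve_length_dist f g :
  `|curve_length f - curve_length g| <= curve_length (f - g).
Proof.
rewrite ler_norml; apply/andP; split.
  rewrite lerNl opprB lerBlDr curve_lengthB_sym.
  by rewrite -{1}(subrK f g) ler_curve_lengthD.
by rewrite lerBlDr -{1}(subrK g f) ler_curve_lengthD.
Qed.

Lemma wderivB f g :
  {ae mu, forall u, `[0, 1]%classic u ->
    wderiv (f - g) u = wderiv f u - wderiv g u}.
Proof.
have := wderiv_linE (-1) g f.
apply: filterS; first exact: (ae_filter_ringOfSetsType mu).
move=> u + uI => /(_ uI).
by rewrite !scaleN1r (addrC (- g)) (addrC (- wderiv g u)).
Qed.

Lemma measurable_wderiv_coord f i :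
  measurable_fun I01 (fun u => wderiv f u 0 i).
Proof.
by apply/measurable_EFinP; exact: measurable_int (integrable_wderiv_coord f i).
Qed.

Lemma integrable_enorm_wderivB f g : mu.-integrable `[0, 1]
  (EFin \o (fun u => enorm (wderiv f u - wderiv g u))).
Proof.
apply: integrable_enorm => // i.
rewrite (_ : _ \o _ = EFin \o (fun u => wderiv f u 0 i - wderiv g u 0 i)).
  by apply: integrable_subr => //; exact: integrable_wderiv_coord.
by apply/funext => u /=; rewrite !mxE.
Qed.

Lemma curve_lengthBE f g : curve_length (f - g) =
  \int[mu]_(u in `[0, 1]) enorm (wderiv f u - wderiv g u).
Proof.
apply: ae_curve_length; first exact: wderivB.
move=> i; rewrite (_ : (fun u => _) =
    (fun u => wderiv f u 0 i - wderiv g u 0 i)); last first.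
  by apply/funext => u; rewrite !mxE.
by apply: measurable_funB; exact: measurable_wderiv_coord.
Qed.

Lemma Rintegral_sub_le (q : R -> R) (u : R) :
  mu.-integrable `[0, 1] (EFin \o q) -> (forall v, 0 <= q v) -> 0 <= u <= 1 ->
  \int[mu]_(v in `[0, u]) q v <= \int[mu]_(v in `[0, 1]) q v.
Proof.
move=> iq q0 /andP[u0 u1].
have := is_primitiveB (is_primitive_Rintegral iq) u0 u1 (lexx 1).
rewrite -subr_ge0 => ->; exact: Rintegral_ge0.
Qed.

Lemma coord_dist_le_length f i (u : R) : 0 <= u <= 1 ->
  `|f u 0 i - f 0 0 i| <= curve_length f.
Proof.
move=> uI; have [ig fE] := is_primitive_W11 f i.
rewrite (fE u uI) addrC addKr.
have isub (F : R -> \bar R) :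
    mu.-integrable `[0, 1] F -> mu.-integrable `[0, u] F.
  by apply: integrable_sub_itv01 => //; case/andP: uI.
apply: le_trans (le_normr_Rintegral _ (isub _ ig)) _ => //.
apply: (@le_trans _ _ (\int[mu]_(v in `[0, u]) enorm (wderiv f v))).
  apply: le_Rintegral => //.
  - by apply: integrable_norm => //; exact: isub.
  - exact/isub/integrable_enorm_wderiv.
  - by move=> v _; exact: coord_le_enorm.
apply: Rintegral_sub_le uI; first exact: integrable_enorm_wderiv.
by move=> v; exact: enorm_ge0.
Qed.

(** Averaging over u the bound |f 0| <= |f u| + length f. *)
Lemma coord0_le_norm f i : `|f 0 0 i| <= W11_norm f.
Proof.
have bnd (u : R) : 0 <= u <= 1 -> `|f 0 0 i| <= enorm (f u) + curve_length f.
  move=> uI.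
  have -> : f 0 0 i = f u 0 i - (f u 0 i - f 0 0 i) by rewrite subKr.
  apply: le_trans (ler_normB _ _) _; apply: lerD; first exact: coord_le_enorm.
  exact: coord_dist_le_length.
have -> : `|f 0 0 i| = \int[mu]_(u in `[0, 1]) `|f 0 0 i|.
  by rewrite Rintegral_cst_itv// mulr1.
have icst (c : R) : mu.-integrable `[0, 1] (EFin \o (fun _ : R => c)).
  by apply: integrable_continuous => x; exact: cvg_cst.
have -> : W11_norm f = \int[mu]_(u in `[0, 1]) (enorm (f u) + curve_length f).
  rewrite RintegralD//; last exact: integrable_enorm_W11.
  by rewrite Rintegral_cst_itv// mulr1.
apply: le_Rintegral => //.
by apply: integrable_addr => //; exact: integrable_enorm_W11.
Qed.

(** An equivalent of the norm of W^{1,1} in which the flow is easier to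
    estimate: the flow field is explicit at the point 0 of the circle, and the
    length of a difference only involves derivatives. *)
Definition base_norm f : R := `|f 0 0 0| + `|f 0 0 1| + curve_length f.

Lemma base_norm_ge0 f : 0 <= base_norm f.
Proof. by rewrite !addr_ge0// curve_length_ge0. Qed.

Lemma coord0_le_base_norm f i : `|f 0 0 i| <= base_norm f.
Proof.
have := curve_length_ge0 f; have := normr_ge0 (f 0 0 0).
have := normr_ge0 (f 0 0 1); rewrite /base_norm.
have [->|->] := ord2_eq0_or_eq1 i.
all: lra.
Qed.

Lemma curve_length_le_base_norm f : curve_length f <= base_norm f.
Proof. by rewrite /base_norm lerDr addr_ge0. Qed.

Lemma W11_addE f g (u : R) : W11_fun (f + g) u = f u + g u.
Proof. by []. Qed.

Lemma W11_subE f g (u : R) : W11_fun (f - g) u = f u - g u.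
Proof. by []. Qed.

Lemma W11_scaleE (a : R) f (u : R) : W11_fun (a *: f) u = a *: f u.
Proof. by []. Qed.

Lemma ler_base_normD f g : base_norm (f + g) <= base_norm f + base_norm g.
Proof.
have c i : `|W11_fun (f + g) 0 0 i| <= `|f 0 0 i| + `|g 0 0 i|.
  by rewrite W11_addE mxE ler_normD.
have sum3 (x y z a b d a' b' d' : R) : x <= a + a' -> y <= b + b' ->
  z <= d + d' -> x + y + z <= a + b + d + (a' + b' + d') by lra.
exact: sum3 (c 0) (c 1) (ler_curve_lengthD f g).
Qed.

Lemma base_normZ (a : R) f : base_norm (a *: f) = `|a| * base_norm f.
Proof.
have c i : `|W11_fun (a *: f) 0 0 i| = `|a| * `|f 0 0 i|.
  by rewrite W11_scaleE mxE normrM.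
by rewrite /base_norm !c curve_lengthZ !mulrDr.
Qed.

Lemma base_norm_le_norm f : base_norm f <= 3 * `|f|.
Proof.
have := curve_length_le_norm f.
have := coord0_le_norm f 0; have := coord0_le_norm f 1.
by rewrite /base_norm -[`|f|]/(W11_norm f); lra.
Qed.

Lemma base_norm0_eq0 f : base_norm f = 0 -> f = 0.
Proof.
move=> f0; have c i : f 0 0 i = 0.
  apply/eqP; rewrite -normr_le0; apply: le_trans (coord0_le_base_norm f i) _.
  by rewrite f0.
have L0 : curve_length f = 0.
  apply/le_anti; rewrite curve_length_ge0 andbT.
  by apply: le_trans (curve_length_le_base_norm f) _; rewrite f0.
have z (u : R) : 0 <= u <= 1 -> f u = 0.
  move=> uI; apply/rowP => i; rewrite mxE.
  have := coord_dist_le_length f i uI; rewrite L0 c subr0 normr_le0.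
  by move/eqP.
apply: W11_norm0_eq0; rewrite /W11_norm -/(curve_length f) L0 addr0.
rewrite (_ : \int[mu]_(u in _) _ = \int[mu]_(u in `[0, 1]) (0 : R)).
  by rewrite Rintegral_cst_itv// mul0r.
apply: eq_Rintegral => u /set_mem/=; rewrite in_itv/= => /z ->.
by rewrite -(scale0r 0) enormZ normr0 mul0r.
Qed.

End curve_calculus.

(** * Convolution in the arclength parameter *)

Section arclength_convolution.
Context {R : realType}.
Notation mu := (@lebesgue_measure R).
Implicit Types (gamma : W11 R) (i : 'I_2) (H K : R -> R).

Lemma is_derive_quadratic (f : R -> R) (x d c : R) :
  (forall y, `|f y - f x - d * (y - x)| <= c * (y - x) ^+ 2) ->
  is_derive x 1 f d.
Proof.
move=> fd.
have : h^-1 *: (f (h *: 1 + x) - f x) @[h --> 0^'] --> d.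
  apply/cvgrPdist_le => e e0.
  have c1 : 0 < `|c| + 1 by rewrite ltr_pwDr.
  have small : \forall h \near (0:R)^', `|h| <= e / (`|c| + 1).
    by apply: dnbhs0_le; rewrite divr_gt0.
  near=> h.
  have h0 : h != 0 by near: h; exact: nbhs_dnbhs_neq.
  have he : `|h| <= e / (`|c| + 1) by near: h.
  rewrite /GRing.scale/= mulr1.
  have := fd (h + x); rewrite addrK => fh.
  have -> : d - h^-1 * (f (h + x) - f x) =
      - (h^-1 * (f (h + x) - f x - d * h)).
    by field.
  rewrite normrN normrM normfV ler_pdivrMl ?normr_gt0//.
  apply: le_trans fh _; rewrite -[h ^+ 2]real_normK ?num_real// expr2 mulrCA.
  apply: ler_wpM2l => //; move: he; rewrite ler_pdivlMr//; apply: le_trans.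
  rewrite mulrC; apply: ler_wpM2l => //.
  by rewrite (le_trans (ler_norm _))// lerDl.
move=> fl; apply: DeriveDef; first by apply/cvg_ex; exists d.
exact: cvg_lim fl.
Unshelve. all: by end_near. Qed.

Section arclength.
Variable gamma : W11 R.
Let L := curve_length gamma.
Let q v := enorm (wderiv gamma v).

Lemma is_primitive_arclen :
  is_primitive (arclen gamma) (fun v => L^-1 * q v).
Proof.
have iq := integrable_enorm_wderiv gamma.
split; first exact: integrable_scaler.
move=> u /andP[u0 u1]; rewrite /arclen set_itv1 Rintegral_set1 mulr0 add0r.
by rewrite RintegralZl//; exact: integrable_sub_itv01 iq.
Qed.

Lemma arclenE u :
  arclen gamma u = L^-1 * \int[mu]_(v in `[0, u]) q v.
Proof. by []. Qed.

Lemma arclen0 : arclen gamma 0 = 0.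
Proof. by rewrite /arclen set_itv1 Rintegral_set1 mulr0. Qed.

Lemma arclen1 : 0 < L -> arclen gamma 1 = 1.
Proof. by move=> L0; rewrite /arclen mulVf// gt_eqF. Qed.

Lemma arclen_itv u : 0 < L -> 0 <= u <= 1 -> 0 <= arclen gamma u <= 1.
Proof.
move=> L0 uI; apply/andP; split.
  rewrite mulr_ge0 ?invr_ge0 ?(ltW L0)//.
  by apply: Rintegral_ge0 => v _; exact: enorm_ge0.
rewrite -[leRHS](arclen1 L0) /arclen; apply: ler_wpM2l.
  by rewrite invr_ge0 ltW.
apply: Rintegral_sub_le uI; first exact: integrable_enorm_wderiv.
by move=> v; exact: enorm_ge0.
Qed.

Lemma arclen_continuous : {within `[0, 1], continuous (arclen gamma)}.
Proof. exact: is_primitive_continuous is_primitive_arclen. Qed.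

(** With H the circle kernel this is the convolution in arclength of the
    derivative of the curve. The arclength r of the point of evaluation is taken
    as the variable, because the dependence on r is as regular as H, while that
    on the point is not. *)
Definition arc_integral H i (r : R) : R :=
  \int[mu]_(v in `[0, 1]) (wderiv gamma v 0 i * H (arclen gamma v - r)).

Lemma shift_arclen_continuous H (r : R) : continuous H ->
  {within `[0, 1], continuous (fun v => H (arclen gamma v - r))}.
Proof.
move=> cH.
apply: (continuous_comp_within cH (f := fun v => arclen gamma v - r)).
apply: within_continuousI => x xI; apply: cvgB; last exact: cvg_cst.
exact: within_cvg arclen_continuous xI.
Qed.

Lemma integrable_arc_integral H i (r : R) : continuous H ->
  mu.-integrable `[0, 1]
    (EFin \o (fun v => wderiv gamma v 0 i * H (arclen gamma v - r))).
Proof.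
move=> cH; apply: integrable_mul_within; first exact: integrable_wderiv_coord.
exact: shift_arclen_continuous.
Qed.

Lemma Rintegral_wderiv_mul_le (k : R -> R) i (e : R) : 0 <= e ->
  mu.-integrable `[0, 1] (EFin \o (fun u => wderiv gamma u 0 i * k u)) ->
  (forall u, 0 <= u <= 1 -> `|k u| <= e) ->
  `|\int[mu]_(u in `[0, 1]) (wderiv gamma u 0 i * k u)| <= e * L.
Proof.
move=> e0 ik ke.
apply: le_trans (Rintegral_norm_mul_le (integrable_wderiv_coord _ _) ik ke) _.
apply: ler_wpM2l => //; apply: le_Rintegral => //.
- by apply: integrable_norm => //; exact: integrable_wderiv_coord.
- exact: integrable_enorm_wderiv.
- by move=> v _; exact: coord_le_enorm.
Qed.

Lemma arc_integral_bounded H i (B r : R) : continuous H -> 0 <= B ->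
  (forall u, 0 <= u <= 1 -> `|H (arclen gamma u - r)| <= B) ->
  `|arc_integral H i r| <= B * L.
Proof.
move=> cH B0 HB; apply: Rintegral_wderiv_mul_le => //.
exact: integrable_arc_integral.
Qed.

Section kernel_with_primitive.
Variables (H K : R -> R) (l : R).
Hypotheses (l0 : 0 <= l) (Hl : forall x y, `|H x - H y| <= l * `|x - y|)
  (dK : forall x : R, is_derive x 1 K (H x)).

Let cH : continuous H. Proof. exact: lipschitz_continuous Hl. Qed.

Let cK : continuous K. Proof. exact: is_derive_continuous dK. Qed.

Lemma lipschitz_derive_taylor2 (x y : R) :
  `|K y - K x - H x * (y - x)| <= l * (y - x) ^+ 2.
Proof.
have inI z : Num.min x y <= z <= Num.max x y -> `|z - x| <= `|y - x|.
  case: (leP x y) => xy /andP[zl zr].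
    by rewrite !ger0_norm ?subr_ge0// lerD2r.
  by rewrite !ler0_norm ?subr_le0 ?(ltW xy)//; lra.
have dP z : is_derive z (1 : R) (fun z => K z - H x * z) (H z - H x).
  by apply: is_derive_eq; rewrite /GRing.scale/=; ring.
have := @bounded_derive_lipschitz _ (fun z => K z - H x * z) _ (l * `|y - x|)
  (Num.min x y) (Num.max x y) (fun z _ => dP z).
move=> /(_ _ y x).
rewrite !ge_min !le_max !lexx !orbT/= => h.
rewrite (_ : _ - _ = K y - H x * y - (K x - H x * x)); last by ring.
rewrite -[(y - x) ^+ 2]real_normK ?num_real// expr2 mulrA; apply: h => //.
move=> z zI; apply: le_trans (Hl z x) _; apply: ler_wpM2l => //; exact: inI.
Qed.

(** Differentiation under the integral sign: the second order Taylor estimate of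
    K is uniform in v. *)
Lemma is_derive_arc_integral i (r : R) :
  is_derive r 1 (arc_integral K i) (- arc_integral H i r).
Proof.
apply: (@is_derive_quadratic _ _ _ (l * L)) => s.
have iK r' := integrable_arc_integral i r' cK.
have iH := integrable_arc_integral i r cH.
rewrite /arc_integral -RintegralB// mulNr opprK mulrC -RintegralZl//.
rewrite -RintegralD//; last 2 first.
- exact: integrable_subr.
- exact: integrable_scaler.
rewrite (_ : \int[mu]_(x in _) _ = \int[mu]_(v in `[0, 1])
    (wderiv gamma v 0 i * (K (arclen gamma v - s) - K (arclen gamma v - r) -
       H (arclen gamma v - r) * (r - s)))); last first.
  by apply: eq_Rintegral => v _; ring.
rewrite mulrAC; apply: Rintegral_wderiv_mul_le.
- by rewrite mulr_ge0// sqr_ge0.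
- rewrite (_ : _ \o _ = EFin \o (fun v =>
     (wderiv gamma v 0 i * K (arclen gamma v - s) -
      wderiv gamma v 0 i * K (arclen gamma v - r)) +
     (s - r) * (wderiv gamma v 0 i * H (arclen gamma v - r)))).
    apply: integrable_addr => //; first exact: integrable_subr.
    exact: integrable_scaler.
  by apply/funext => v /=; congr EFin; ring.
move=> v _.
have := lipschitz_derive_taylor2 (arclen gamma v - r) (arclen gamma v - s).
rewrite (_ : arclen gamma v - s - (arclen gamma v - r) = r - s); last by ring.
by rewrite -[(s - r) ^+ 2]sqrrN opprB.
Qed.

Lemma arc_integral_continuous i : continuous (arc_integral H i).
Proof.
apply: (@lipschitz_continuous _ _ (l * L)) => r s.
have iH r' := integrable_arc_integral i r' cH.
rewrite /arc_integral -RintegralB//.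
under eq_Rintegral do rewrite -mulrBr.
rewrite mulrAC; apply: Rintegral_wderiv_mul_le; first by rewrite mulr_ge0.
  rewrite (_ : _ \o _ = EFin \o (fun v =>
     wderiv gamma v 0 i * H (arclen gamma v - r) -
     wderiv gamma v 0 i * H (arclen gamma v - s))).
    exact: integrable_subr.
  by apply/funext => v /=; rewrite mulrBr.
move=> v _; apply: le_trans (Hl _ _) _; apply: ler_wpM2l => //.
rewrite distrC (_ : arclen gamma v - s - (arclen gamma v - r) = r - s)//.
by ring.
Qed.

(** Since H (arclen gamma v - r) |gamma' v| / L is the derivative of
    v |-> K (arclen gamma v - r), an integration by parts moves the derivative
    to gamma. The boundary term is gamma 0 times the increment of K over one
    turn. *)
Lemma arc_integral_by_parts i (r : R) : 0 < L ->
  (forall x, K (x + 1) = K x + K 1) ->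
  \int[mu]_(v in `[0, 1]) (gamma v 0 i * H (arclen gamma v - r) * (q v / L)) =
  K 1 * gamma 0 0 i - arc_integral K i r.
Proof.
move=> L0 Kper.
have dKr (x : R) : is_derive x 1 (fun x => K (x - r)) (H (x - r)).
  rewrite -[H (x - r)]mulr1; apply: (@is_derive1_comp _ K (fun x => x - r)).
  by apply: is_derive_eq; rewrite subr0.
have cHr : continuous (fun x => H (x - r)).
  move=> x; apply: (@continuous_comp _ _ _ (fun x => x - r) H); last exact: cH.
  by apply: cvgB; [exact: cvg_id|exact: cvg_cst].
have pK := is_primitive_comp dKr cHr is_primitive_arclen.
have pg := is_primitive_W11 gamma i.
have [_ /(_ 1)] := is_primitive_mul pg pK.
rewrite ler01 lexx => /(_ isT)/=.
rewrite W11_at1.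
have cg : {within `[0, 1], continuous (fun u => gamma u 0 i)}.
  exact/continuous_subspaceT/continuous_coord/W11_continuous.
have ip := integrable_mul_within pK.1 cg.
rewrite RintegralD//; last exact: integrable_arc_integral.
rewrite -/(arc_integral K i r) arclen0 arclen1// addrC Kper sub0r => e.
transitivity (\int[mu]_(u in `[0, 1])
    (L^-1 * q u * H (arclen gamma u - r) * gamma u 0 i)).
  by apply: eq_Rintegral => v _; ring.
by move: e; lra.
Qed.

End kernel_with_primitive.

End arclength.

End arclength_convolution.

(** * The derivative of the flow field *)

Section flow_estimates.
Context {R : realType}.
Notation mu := (@lebesgue_measure R).
Local Notation I01 := (`[0, 1]%classic : set (measurableTypeR R)).
Implicit Types (gamma F : W11 R) (i : 'I_2).

Variable lambda : R.
Let G := circle_kernel lambda.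

Variables (K : R -> R) (l B : R).
Hypotheses (l0 : 0 <= l) (Gl : forall x y, `|G x - G y| <= l * `|x - y|)
  (B0 : 0 <= B) (GB : forall x, `|G x| <= B)
  (dK : forall x : R, is_derive x 1 K (G x))
  (Kper : forall x, K (x + 1) = K x + K 1).

Let cG : continuous G. Proof. exact: lipschitz_continuous Gl. Qed.

(** The derivative of the flow field along the curve: differentiation commutes
    with the convolution in arclength. *)
Definition flow_velocity b gamma (u : R) : 'rV[R]_2 :=
  - (curve_length gamma `^ (b - 2) / lambda ^+ 2) *:
    (wderiv gamma u + (enorm (wderiv gamma u) / curve_length gamma) *:
       \row_i arc_integral gamma G i (arclen gamma u)).

Lemma curve_conv_by_parts gamma u i : 0 < curve_length gamma ->
  curve_conv lambda gamma u 0 i =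
  K 1 * gamma 0 0 i - arc_integral gamma K i (arclen gamma u).
Proof. by move=> L0; rewrite mxE; exact: (arc_integral_by_parts Gl dK). Qed.

(** After the integration by parts, u enters the convolution only through
    K (arclen gamma v - arclen gamma u), where K is differentiable, so that the
    chain rule applies. *)
Lemma is_primitive_curve_conv gamma i : 0 < curve_length gamma ->
  is_primitive (fun u => curve_conv lambda gamma u 0 i)
    (fun u => (curve_length gamma)^-1 * enorm (wderiv gamma u) *
       arc_integral gamma G i (arclen gamma u)).
Proof.
move=> L0.
have dPhi (r : R) : is_derive r 1
    (fun r => K 1 * gamma 0 0 i - arc_integral gamma K i r)
    (arc_integral gamma G i r).
  have dN := is_derive_arc_integral gamma l0 Gl dK i r.
  by apply: is_derive_eq; rewrite add0r mul1r opprK.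
have := is_primitive_comp dPhi (@arc_integral_continuous _ gamma _ _ l0 Gl i)
  (is_primitive_arclen gamma).
by apply: eq_is_primitive => // u _ /=; rewrite curve_conv_by_parts.
Qed.

Lemma is_primitive_flow b gamma i : 0 < curve_length gamma ->
  is_primitive (fun u => flow_field lambda b gamma u 0 i)
    (fun u => flow_velocity b gamma u 0 i).
Proof.
move=> L0; set c := - (curve_length gamma `^ (b - 2) / lambda ^+ 2).
have := is_primitive_lin c (is_primitive_lin 1 (is_primitive_W11 gamma i)
  (is_primitive_curve_conv i L0)) is_primitive0.
apply: eq_is_primitive => u _; rewrite ?/flow_field ?/flow_velocity.
  by rewrite gt_eqF// -/c !mxE; ring.
by rewrite -/c !mxE; ring.
Qed.

Section image_curve.
Variables (b : R) (gamma F : W11 R).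
Hypotheses (L0 : 0 < curve_length gamma)
  (FE : forall u, 0 <= u <= 1 -> F u = flow_field lambda b gamma u).

Lemma wderiv_flow : {ae mu, forall u, `[0, 1]%classic u ->
  wderiv F u = flow_velocity b gamma u}.
Proof.
apply: (@wderiv_unique _ F); first exact: wderivP.
move=> i; have pF : is_primitive (fun u => F u 0 i)
    (fun u => flow_velocity b gamma u 0 i).
  apply: eq_is_primitive (is_primitive_flow b i L0) => // u /FE.
  by move=> ->.
split; first exact: pF.1.
move=> phi; apply: is_primitive_weak => //.
by rewrite W11_at1.
Qed.

Lemma measurable_flow_velocity i :
  measurable_fun I01 (fun u => flow_velocity b gamma u 0 i).
Proof.
have [ig _] := is_primitive_flow b i L0.
by apply/measurable_EFinP; exact: measurable_int ig.
Qed.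

Lemma curve_length_flow :
  curve_length F = \int[mu]_(u in `[0, 1]) enorm (flow_velocity b gamma u).
Proof.
apply: ae_curve_length; first exact: wderiv_flow.
exact: measurable_flow_velocity.
Qed.

Lemma enorm_arc_integral_le (H : R -> R) (C u : R) : continuous H -> 0 <= C ->
  (forall x, -1 <= x <= 1 -> `|H x| <= C) -> 0 <= u <= 1 ->
  enorm (\row_i arc_integral gamma H i (arclen gamma u)) <=
  2 * C * curve_length gamma.
Proof.
move=> cH C0 HC uI; apply: le_trans (enorm_le _) _; rewrite !mxE.
have J i : `|arc_integral gamma H i (arclen gamma u)| <= C * curve_length gamma.
  apply: arc_integral_bounded => // v vI; apply: HC.
  have := arclen_itv L0 vI; have := arclen_itv L0 uI; lra.
have := J 0; have := J 1; lra.
Qed.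

(** The speed |gamma' u| is a factor of each of the two terms of the
    velocity. *)
Lemma curve_length_flow_le : curve_length F <=
  curve_length gamma `^ (b - 2) / lambda ^+ 2 * (1 + 2 * B) *
    curve_length gamma.
Proof.
set c := curve_length gamma `^ (b - 2) / lambda ^+ 2.
have c0 : 0 <= c by rewrite divr_ge0 ?powR_ge0// exprn_even_ge0.
set L := curve_length gamma; set q := fun u => enorm (wderiv gamma u).
rewrite curve_length_flow.
have iq := integrable_enorm_wderiv gamma.
have -> : c * (1 + 2 * B) * L =
    \int[mu]_(u in `[0, 1]) (c * (1 + 2 * B) * q u) by rewrite RintegralZl.
apply: le_Rintegral => //.
- by apply: integrable_enorm => // i; have [] := is_primitive_flow b i L0.
- exact: integrable_scaler.
move=> u /=; rewrite in_itv/= => uI; rewrite /flow_velocity -/c enormZ.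
rewrite normrN ger0_norm// -mulrA; apply: ler_wpM2l => //.
apply: le_trans (ler_enormD _ _) _; rewrite mulrDl mul1r lerD2l enormZ.
rewrite ger0_norm ?divr_ge0 ?enorm_ge0 ?(ltW L0)//.
have := enorm_arc_integral_le cG B0 (fun x _ => GB x) uI.
move=> /(ler_wpM2l (_ : 0 <= q u / L)) => /(_ _)/le_trans; apply.
  by rewrite divr_ge0 ?enorm_ge0 ?(ltW L0).
by rewrite -/L le_eqVlt; apply/predU1P; left; field; rewrite gt_eqF.
Qed.

End image_curve.

End flow_estimates.

(** * Lipschitz dependence of the flow field on the curve *)

Lemma ler_inv_pos (R : realFieldType) (x y : R) :
  0 < x -> x <= y -> y^-1 <= x^-1.
Proof. by move=> x0 xy; rewrite lef_pV2// posrE (lt_le_trans x0). Qed.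

Section arclength_stability.
Context {R : realType}.
Notation mu := (@lebesgue_measure R).
Implicit Types (gamma F : W11 R) (i : 'I_2).

Variables (m M : R) (gamma1 gamma2 : W11 R).

Variables L1 L2 D : R.
Hypotheses (L1E : L1 = curve_length gamma1) (L2E : L2 = curve_length gamma2)
  (DE : D = curve_length (gamma1 - gamma2)).
Hypotheses (m0 : 0 < m) (mL1 : m <= L1) (mL2 : m <= L2) (LM2 : L2 <= M).

Let D0 : 0 <= D. Proof. by rewrite DE curve_length_ge0. Qed.
Let L10 : 0 < L1. Proof. exact: lt_le_trans mL1. Qed.
Let L20 : 0 < L2. Proof. exact: lt_le_trans mL2. Qed.
Let D12 : `|L2 - L1| <= D.
Proof. by rewrite distrC L1E L2E DE ler_curve_length_dist. Qed.

Lemma Rintegral_speed_dist_le u : 0 <= u <= 1 ->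
  `|\int[mu]_(v in `[0, u]) enorm (wderiv gamma1 v) -
    \int[mu]_(v in `[0, u]) enorm (wderiv gamma2 v)| <= D.
Proof.
move=> uI; rewrite DE curve_lengthBE.
have mI : measurable (`[0, u]%classic : set (measurableTypeR R)).
  exact: measurable_itv.
have sub (h : R -> \bar R) :
    mu.-integrable `[0, 1] h -> mu.-integrable `[0, u] h.
  by apply: integrable_sub_itv01 => //; case/andP: uI.
have iq1 := sub _ (integrable_enorm_wderiv gamma1).
have iq2 := sub _ (integrable_enorm_wderiv gamma2).
rewrite -(RintegralB mI iq1 iq2).
have iq := integrable_subr mI iq1 iq2.
apply: le_trans (le_normr_Rintegral mI iq) _.
apply: (@le_trans _ _ (\int[mu]_(v in `[0, u])
    enorm (wderiv gamma1 v - wderiv gamma2 v))).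
  apply: (le_Rintegral mI (integrable_norm iq)
    (sub _ (integrable_enorm_wderivB gamma1 gamma2))) => v _.
  exact: ler_enormB_dist.
apply: Rintegral_sub_le uI; first exact: integrable_enorm_wderivB.
by move=> v; exact: enorm_ge0.
Qed.

(** The difference of the arclengths is split into the difference of the
    unnormalised arclengths and that of the total lengths; each contributes at
    most D / m. *)
Lemma arclen_dist_le u : 0 <= u <= 1 ->
  `|arclen gamma1 u - arclen gamma2 u| <= 2 * (D / m).
Proof.
move=> uI; have := Rintegral_speed_dist_le uI.
have : 0 <= arclen gamma2 u <= 1 by apply: arclen_itv => //; rewrite -L2E.
rewrite !arclenE -L1E -L2E.
move: (\int[mu]_(v in _) _) (\int[mu]_(v in _) _) => P1 P2 /andP[r0 r1] P12.
have -> : L1^-1 * P1 - L2^-1 * P2 =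
    L1^-1 * (P1 - P2) + L1^-1 * (L2^-1 * P2 * (L2 - L1)).
  by field; rewrite !gt_eqF.
have L1m : L1^-1 <= m^-1 := ler_inv_pos m0 mL1.
have bnd (x : R) : `|x| <= D -> `|L1^-1 * x| <= D / m.
  move=> xD; rewrite normrM ger0_norm ?invr_ge0 ?(ltW L10)// mulrC.
  by apply: ler_pM => //; rewrite invr_ge0 ltW.
apply: le_trans (ler_normD _ _) _; rewrite mulrDl mul1r.
apply: lerD; apply: bnd => //.
rewrite normrM ger0_norm//.
apply: (@le_trans _ _ (1 * D)); last by rewrite mul1r.
exact: ler_pM.
Qed.

(** Replacing gamma1' by gamma2' costs C D. Replacing the arclengths in the
    Lipschitz function H costs l times four arclength errors of D / m, two at v
    and two at u, integrated against gamma2'. *)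
Lemma arc_integral_dist_le (H : R -> R) i (C l u : R) : continuous H ->
  0 <= C -> (forall x : R, -1 <= x <= 1 -> `|H x| <= C) ->
  0 <= l -> (forall x y, `|H x - H y| <= l * `|x - y|) -> 0 <= u <= 1 ->
  `|arc_integral gamma1 H i (arclen gamma1 u) -
    arc_integral gamma2 H i (arclen gamma2 u)| <= (C + l * (4 / m) * M) * D.
Proof.
move=> cH C0 HC l0 Hl uI.
have dist := arclen_dist_le.
have itv1 (v : R) : 0 <= v <= 1 -> 0 <= arclen gamma1 v <= 1.
  by move=> vI; apply: arclen_itv => //; rewrite -L1E.
have := dist u uI; have := itv1 u uI.
move: (arclen gamma1 u) (arclen gamma2 u) => r1 r2 r1I r12.
pose g1 v := wderiv gamma1 v 0 i; pose g2 v := wderiv gamma2 v 0 i.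
pose H1 v := H (arclen gamma1 v - r1); pose H2 v := H (arclen gamma2 v - r2).
have c1 : {within `[0, 1], continuous H1} by exact: shift_arclen_continuous.
have c2 : {within `[0, 1], continuous H2} by exact: shift_arclen_continuous.
have mI : measurable (`[0, 1]%classic : set (measurableTypeR R)).
  exact: measurable_itv.
have ig1 : mu.-integrable `[0, 1] (EFin \o g1) := integrable_wderiv_coord _ _.
have ig2 : mu.-integrable `[0, 1] (EFin \o g2) := integrable_wderiv_coord _ _.
have ig12 := integrable_subr mI ig1 ig2.
have cH12 : {within `[0, 1], continuous (fun v => H1 v - H2 v)}.
  apply: within_continuousI => x xI.
  by apply: cvgB; [exact: within_cvg c1 xI|exact: within_cvg c2 xI].
have i1 := integrable_mul_within ig12 c1.
have i2 := integrable_mul_within ig2 cH12.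
have e : arc_integral gamma1 H i r1 - arc_integral gamma2 H i r2 =
    \int[mu]_(v in `[0, 1]) ((g1 v - g2 v) * H1 v) +
    \int[mu]_(v in `[0, 1]) (g2 v * (H1 v - H2 v)).
  rewrite -(RintegralD mI i1 i2).
  rewrite /arc_integral -(RintegralB mI (integrable_arc_integral gamma1 i r1 cH)
    (integrable_arc_integral gamma2 i r2 cH)).
  by apply: eq_Rintegral => v _; rewrite /g1 /g2 /H1 /H2; ring.
rewrite e; apply: le_trans (ler_normD _ _) _; rewrite mulrDl.
apply: lerD.
  have HC1 v : 0 <= v <= 1 -> `|H1 v| <= C.
    by move=> vI; apply: HC; have := itv1 _ vI; lra.
  apply: le_trans (Rintegral_norm_mul_le ig12 i1 HC1) _.
  apply: ler_wpM2l => //; rewrite DE curve_lengthBE.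
  apply: (le_Rintegral mI (integrable_norm ig12)
    (integrable_enorm_wderivB gamma1 gamma2)) => v _.
  apply: le_trans (coord_le_enorm _ i).
  by rewrite [X in _ <= `|X|]mxE [X in _ <= `|_ + X|]mxE.
have H12 v : 0 <= v <= 1 -> `|H1 v - H2 v| <= l * (4 * (D / m)).
  move=> vI; apply: le_trans (Hl _ _) _; apply: ler_wpM2l => //.
  have := dist v vI; move: r12.
  move: (arclen gamma1 v) (arclen gamma2 v) => s1 s2.
  by rewrite !ler_norml => /andP[? ?] /andP[? ?]; apply/andP; split; lra.
have lD : 0 <= l * (4 * (D / m)).
  by rewrite !mulr_ge0// invr_ge0 ltW.
apply: le_trans (Rintegral_wderiv_mul_le lD i2 H12) _.
rewrite -L2E (_ : _ * D = l * (4 * (D / m)) * M); last by ring.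
exact: ler_wpM2l.
Qed.

End arclength_stability.

Section flow_lipschitz.
Context {R : realType}.
Notation mu := (@lebesgue_measure R).
Implicit Types (gamma F : W11 R) (i : 'I_2).

Lemma flow_coef_lipschitz (lambda b m M : R) : 0 < m ->
  exists la A : R, [/\ 0 <= la, 0 <= A,
    forall x y, m <= x <= M -> m <= y <= M ->
      `|x `^ (b - 2) / lambda ^+ 2 - y `^ (b - 2) / lambda ^+ 2| <=
      la * `|x - y| &
    forall x, m <= x <= M -> `|x `^ (b - 2) / lambda ^+ 2| <= A].
Proof.
move=> m0.
have dp (p x : R) : m <= x <= M ->
    is_derive x 1 (fun x => x `^ p) (p * x `^ (p - 1)).
  by move=> /andP[mx _]; apply: is_derive1_powR; exact: lt_le_trans mx.
have cp (p : R) : {within `[m, M], continuous (fun x => x `^ p)}.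
  apply: derivable_within_continuous => x; rewrite in_itv/= => xI.
  by have := dp p x xI => dpx; exact: ex_derive.
have da (x : R) : m <= x <= M ->
    is_derive x 1 (fun x => x `^ (b - 2) / lambda ^+ 2)
      ((b - 2) * x `^ (b - 2 - 1) / lambda ^+ 2).
  move=> xI; have dpx := dp (b - 2) x xI.
  by apply: is_derive_eq; rewrite scaler0 add0r /GRing.scale/= mulrC.
have cda : {within `[m, M], continuous (fun x : R =>
    (b - 2) * x `^ (b - 2 - 1) / lambda ^+ 2)}.
  apply: within_continuousI => x xI; apply: cvgM; last exact: cvg_cst.
  by apply: cvgM; [exact: cvg_cst|exact: within_cvg (cp _) xI].
have ca : {within `[m, M], continuous (fun x : R =>
    x `^ (b - 2) / lambda ^+ 2)}.
  apply: within_continuousI => x xI; apply: cvgM; last exact: cvg_cst.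
  exact: within_cvg (cp _) xI.
have [la la0 laP] := C1_lipschitz da cda.
have [A A0 AP] := within_continuous_bounded ca.
by exists la, A.
Qed.

Lemma row_subE (v w : 'rV[R]_2) i : (v - w) 0 i = v 0 i - w 0 i.
Proof. by rewrite !mxE. Qed.

Lemma enorm_sum5 (v1 v2 v3 v4 v5 : 'rV[R]_2) :
  enorm (v1 + v2 + v3 + v4 + v5) <=
  enorm v1 + enorm v2 + enorm v3 + enorm v4 + enorm v5.
Proof. by do 4![apply: le_trans (ler_enormD _ _) _; rewrite lerD2r]. Qed.

(** The velocities are polynomial in a, g, J and the normalised speed
    p = |g| / L; the difference is telescoped by changing one factor at a
    time. *)
Lemma enorm_velocity_dist_le (a1 a2 A dA L1 L2 m D J dJ : R)
    (g1 g2 J1 J2 : 'rV[R]_2) :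
  0 < m -> m <= L1 -> m <= L2 -> `|L2 - L1| <= D -> `|a1| <= A -> `|a2| <= A ->
  `|a1 - a2| <= dA -> enorm J1 <= J -> enorm (J1 - J2) <= dJ ->
  enorm (- a1 *: (g1 + (enorm g1 / L1) *: J1) -
         - a2 *: (g2 + (enorm g2 / L2) *: J2)) <=
  (A + A * J / m) * enorm (g1 - g2) + dA * J / m * enorm g1 +
  (dA + A * J * D / m / m + A * dJ / m) * enorm g2.
Proof.
move=> m0 mL1 mL2 L12 a1A a2A a12 J1J J12.
have L10 : 0 < L1 := lt_le_trans m0 mL1.
have L20 : 0 < L2 := lt_le_trans m0 mL2.
have L1m := ler_inv_pos m0 mL1; have L2m := ler_inv_pos m0 mL2.
have i1 : 0 <= L1^-1 by rewrite invr_ge0 ltW.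
have i2 : 0 <= L2^-1 by rewrite invr_ge0 ltW.
have im : 0 <= m^-1 by rewrite invr_ge0 ltW.
have q1 := enorm_ge0 g1; have q2 := enorm_ge0 g2.
have dq := ler_enormB_dist g1 g2; have d0 := enorm_ge0 (g1 - g2).
have A0 : 0 <= A := le_trans (normr_ge0 _) a1A.
have dA0 : 0 <= dA := le_trans (normr_ge0 _) a12.
have D0 : 0 <= D := le_trans (normr_ge0 _) L12.
set p1 := enorm g1 / L1; set p2 := enorm g2 / L2.
have p1m : `|p1| <= enorm g1 / m.
  by rewrite ger0_norm ?mulr_ge0//; exact: ler_wpM2l.
have p2m : `|p2| <= enorm g2 / m.
  by rewrite ger0_norm ?mulr_ge0//; exact: ler_wpM2l.
have p12 : `|p1 - p2| <= enorm (g1 - g2) / m + enorm g2 / m * D / m.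
  have -> : p1 - p2 = (enorm g1 - enorm g2) / L1 + p2 * (L2 - L1) / L1.
    by rewrite /p1 /p2; field; rewrite !gt_eqF.
  apply: le_trans (ler_normD _ _) _; apply: lerD; rewrite normrM (ger0_norm i1).
    exact: ler_pM.
  apply: ler_pM => //; rewrite normrM; exact: ler_pM.
clearbody p1 p2.
rewrite [X in enorm X](_ : _ = - a1 *: (g1 - g2) + (a2 - a1) *: g2 +
    ((a2 - a1) * p1) *: J1 + (- a2 * (p1 - p2)) *: J1 +
    (- a2 * p2) *: (J1 - J2)); last first.
  by apply/rowP => i; rewrite !mxE; ring.
apply: le_trans (enorm_sum5 _ _ _ _ _) _; rewrite !enormZ !normrM !normrN.
rewrite [`|a2 - a1|]distrC.
have h1 : `|a1| * enorm (g1 - g2) <= A * enorm (g1 - g2) by exact: ler_wpM2r.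
have h2 : `|a1 - a2| * enorm g2 <= dA * enorm g2 by exact: ler_wpM2r.
have h3 : `|a1 - a2| * `|p1| * enorm J1 <= dA * (enorm g1 / m) * J.
  apply: ler_pM; rewrite ?mulr_ge0 ?enorm_ge0//; exact: ler_pM.
have h4 : `|a2| * `|p1 - p2| * enorm J1 <=
    A * (enorm (g1 - g2) / m + enorm g2 / m * D / m) * J.
  apply: ler_pM; rewrite ?mulr_ge0 ?enorm_ge0//; exact: ler_pM.
have h5 : `|a2| * `|p2| * enorm (J1 - J2) <= A * (enorm g2 / m) * dJ.
  apply: ler_pM; rewrite ?mulr_ge0 ?enorm_ge0//; exact: ler_pM.
apply: le_trans (lerD (lerD (lerD (lerD h1 h2) h3) h4) h5) _.
by rewrite le_eqVlt; apply/predU1P; left; ring.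
Qed.

Section two_curves.
Variables (lambda b m M l B la A : R) (K : R -> R).
Let G := circle_kernel lambda.
Hypotheses (l0 : 0 <= l) (Gl : forall x y, `|G x - G y| <= l * `|x - y|)
  (B0 : 0 <= B) (GB : forall x, `|G x| <= B)
  (dK : forall x : R, is_derive x 1 K (G x)) (K0 : K 0 = 0)
  (Kper : forall x, K (x + 1) = K x + K 1).
Hypothesis la0 : 0 <= la.
Hypothesis laP : forall x y : R, m <= x <= M -> m <= y <= M ->
  `|x `^ (b - 2) / lambda ^+ 2 - y `^ (b - 2) / lambda ^+ 2| <= la * `|x - y|.
Hypothesis AP : forall x : R, m <= x <= M -> `|x `^ (b - 2) / lambda ^+ 2| <= A.
Hypothesis m0 : 0 < m.

Variables (gamma1 gamma2 F1 F2 : W11 R) (L1 L2 D : R).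
Hypotheses (L1E : L1 = curve_length gamma1) (L2E : L2 = curve_length gamma2)
  (DE : D = curve_length (gamma1 - gamma2)).
Hypotheses (L1I : m <= L1 <= M) (L2I : m <= L2 <= M).
Hypotheses
  (FE1 : forall u, 0 <= u <= 1 -> F1 u = flow_field lambda b gamma1 u)
  (FE2 : forall u, 0 <= u <= 1 -> F2 u = flow_field lambda b gamma2 u).

Let cG : continuous G. Proof. exact: lipschitz_continuous Gl. Qed.
Let mL1 : m <= L1. Proof. by case/andP: L1I. Qed.
Let mL2 : m <= L2. Proof. by case/andP: L2I. Qed.
Let LM1 : L1 <= M. Proof. by case/andP: L1I. Qed.
Let LM2 : L2 <= M. Proof. by case/andP: L2I. Qed.
Let L10 : 0 < L1. Proof. exact: lt_le_trans mL1. Qed.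
Let L20 : 0 < L2. Proof. exact: lt_le_trans mL2. Qed.
Let M0 : 0 <= M. Proof. exact: le_trans (ltW L10) LM1. Qed.
Let D0 : 0 <= D. Proof. by rewrite DE curve_length_ge0. Qed.
Let D12 : `|L2 - L1| <= D.
Proof. by rewrite distrC L1E L2E DE ler_curve_length_dist. Qed.

Let a1 := L1 `^ (b - 2) / lambda ^+ 2.
Let a2 := L2 `^ (b - 2) / lambda ^+ 2.

Let a12 : `|a1 - a2| <= la * D.
Proof.
have := laP L1I L2I; rewrite -/a1 -/a2 => /le_trans; apply.
by apply: ler_wpM2l; rewrite // distrC.
Qed.

Let J gamma u : 'rV[R]_2 := \row_i arc_integral gamma G i (arclen gamma u).

Let flow_velocityE gamma (L : R) u : L = curve_length gamma ->
  flow_velocity lambda b gamma u = - (L `^ (b - 2) / lambda ^+ 2) *: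
    (wderiv gamma u + (enorm (wderiv gamma u) / L) *: J gamma u).
Proof. by move=> ->. Qed.

Let CJ := B + l * (4 / m) * M.

Let J1_le u : 0 <= u <= 1 -> enorm (J gamma1 u) <= 2 * B * M.
Proof.
move=> uI; have L10' : 0 < curve_length gamma1 by rewrite -L1E.
have := enorm_arc_integral_le L10' cG B0 (fun x _ => GB x) uI.
rewrite -L1E => /le_trans; apply; apply: ler_wpM2l => //; exact: mulr_ge0.
Qed.

Let J12_le u : 0 <= u <= 1 -> enorm (J gamma1 u - J gamma2 u) <= 2 * (CJ * D).
Proof.
move=> uI; apply: le_trans (enorm_le _) _.
have d i := arc_integral_dist_le L1E L2E DE m0 mL1 mL2 LM2 i cG B0
  (fun x _ => GB x) l0 Gl uI.
have -> : 2 * (CJ * D) = CJ * D + CJ * D by rewrite mulr_natl.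
rewrite !mxE; exact: lerD (d 0) (d 1).
Qed.

Let c1 := A + A * (2 * B * M) / m.
Let c2 := la * D * (2 * B * M) / m.
Let c3 := la * D + A * (2 * B * M) * D / m / m + A * (2 * (CJ * D)) / m.

Lemma curve_length_flow_dist_le :
  curve_length (F1 - F2) <= c1 * D + c2 * L1 + c3 * L2.
Proof.
have L10' : 0 < curve_length gamma1 by rewrite -L1E.
have L20' : 0 < curve_length gamma2 by rewrite -L2E.
pose V1 := flow_velocity lambda b gamma1.
pose V2 := flow_velocity lambda b gamma2.
have ae1 := wderiv_flow l0 Gl dK Kper L10' FE1.
have ae2 := wderiv_flow l0 Gl dK Kper L20' FE2.
have iV i : mu.-integrable `[0, 1] (EFin \o (fun u => (V1 u - V2 u) 0 i)).
  have [i1 _] := is_primitive_flow l0 Gl dK Kper b i L10'.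
  have [i2 _] := is_primitive_flow l0 Gl dK Kper b i L20'.
  have := integrable_subr (measurable_itv _) i1 i2.
  congr (_.-integrable _ _).
  by apply: funext => u; rewrite /comp row_subE.
have -> : curve_length (F1 - F2) =
    \int[mu]_(u in `[0, 1]) enorm (V1 u - V2 u).
  apply: ae_curve_length; last first.
    by move=> i; apply/measurable_EFinP; exact: measurable_int (iV i).
  have ae3 := wderivB F1 F2.
  have ae12 : {ae mu, forall u, `[0, 1]%classic u ->
      wderiv F1 u - wderiv F2 u = V1 u - V2 u}.
    move: ae1 ae2; apply: filterS2; first exact: (ae_filter_ringOfSetsType mu).
    by move=> u h1 h2 uI; rewrite (h1 uI) (h2 uI).
  move: ae3 ae12; apply: filterS2; first exact: (ae_filter_ringOfSetsType mu).
  by move=> u h1 h2 uI; rewrite (h1 uI) (h2 uI).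
have mI : measurable (`[0, 1]%classic : set (measurableTypeR R)).
  exact: measurable_itv.
have id := integrable_scaler mI c1 (integrable_enorm_wderivB gamma1 gamma2).
have i1 := integrable_scaler mI c2 (integrable_enorm_wderiv gamma1).
have i2 := integrable_scaler mI c3 (integrable_enorm_wderiv gamma2).
have id1 := integrable_addr mI id i1.
have -> : c1 * D + c2 * L1 + c3 * L2 = \int[mu]_(u in `[0, 1])
    (c1 * enorm (wderiv gamma1 u - wderiv gamma2 u) +
     c2 * enorm (wderiv gamma1 u) + c3 * enorm (wderiv gamma2 u)).
  rewrite (RintegralD mI id1 i2) (RintegralD mI id i1).
  rewrite (RintegralZl _ mI (integrable_enorm_wderivB gamma1 gamma2)).
  rewrite (RintegralZl _ mI (integrable_enorm_wderiv gamma1)).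
  rewrite (RintegralZl _ mI (integrable_enorm_wderiv gamma2)).
  by rewrite DE L1E L2E curve_lengthBE.
apply: (le_Rintegral mI (integrable_enorm mI iV) (integrable_addr mI id1 i2)).
move=> u; rewrite /= in_itv/= => uI.
rewrite /V1 /V2 (flow_velocityE u L1E) (flow_velocityE u L2E) -/a1 -/a2.
exact: (enorm_velocity_dist_le _ _ m0 mL1 mL2 D12 (AP L1I) (AP L2I) a12
  (J1_le uI) (J12_le uI)).
Qed.

Let Kl (x y : R) : `|K x - K y| <= B * `|x - y|.
Proof. exact: bounded_derive_lipschitzT dK GB x y. Qed.

Let KB (x : R) : -1 <= x <= 1 -> `|K x| <= B.
Proof.
move=> xI; have := Kl x 0; rewrite K0 !subr0 => /le_trans; apply.
by rewrite ler_piMr// ler_norml.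
Qed.

Let cK : continuous K. Proof. exact: is_derive_continuous dK. Qed.

Let CN := B + B * (4 / m) * M.

Lemma coord0_flow_dist_le i : `|gamma2 0 0 i| <= M ->
  `|W11_fun (F1 - F2) 0 0 i| <=
  A * (1 + `|K 1|) * `|W11_fun (gamma1 - gamma2) 0 0 i| + A * (CN * D) +
  la * D * ((1 + `|K 1|) * M + B * M).
Proof.
have I0 : 0 <= (0 : R) <= 1 by rewrite lexx ler01.
have L10' : 0 < curve_length gamma1 by rewrite -L1E.
have L20' : 0 < curve_length gamma2 by rewrite -L2E.
have F0E gamma F (L : R) : L = curve_length gamma -> 0 < L ->
    (forall u, 0 <= u <= 1 -> F u = flow_field lambda b gamma u) ->
    F 0 0 i = - (L `^ (b - 2) / lambda ^+ 2) * ((1 + K 1) * gamma 0 0 i -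
      arc_integral gamma K i (arclen gamma 0)).
  move=> -> L0 FE; rewrite (FE 0 I0) /flow_field gt_eqF//.
  rewrite mxE mxE (curve_conv_by_parts Gl dK Kper 0 i L0).
  by rewrite mulrDl mul1r addrA.
have N2 : `|arc_integral gamma2 K i (arclen gamma2 0)| <= B * L2.
  rewrite L2E; apply: arc_integral_bounded => // u uI; apply: KB.
  rewrite arclen0 subr0.
  have /andP[r0 r1] := arclen_itv L20' uI.
  apply/andP; split; last exact: r1.
  exact: le_trans (lerN10 R) r0.
have := arc_integral_dist_le L1E L2E DE m0 mL1 mL2 LM2 i cK B0 KB B0 Kl I0.
rewrite !W11_subE !mxE (F0E _ _ _ L1E L10 FE1) (F0E _ _ _ L2E L20 FE2).
rewrite -/a1 -/a2 -/CN.
move: (arc_integral gamma1 K i _) (arc_integral gamma2 K i _) N2.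
move=> N1 N2 N2B; move: (gamma1 0 0 i) (gamma2 0 0 i) => x1 x2 N12 x2M.
have K1 : `|1 + K 1| <= 1 + `|K 1|.
  by rewrite (le_trans (ler_normD _ _))// normr1.
have a1A : `|a1| <= A by exact: AP.
move: a12 a1A; move: a1 a2 => s1 s2 s12 s1A.
rewrite [X in `|X|](_ : _ = - (s1 * (1 + K 1) * (x1 - x2)) + s1 * (N1 - N2) -
  (s1 - s2) * ((1 + K 1) * x2 - N2)); last by ring.
apply: le_trans (ler_normB _ _) _; apply: lerD.
  apply: le_trans (ler_normD _ _) _; rewrite normrN !normrM; apply: lerD.
    by apply: ler_wpM2r => //; exact: ler_pM.
  exact: ler_pM.
rewrite normrM; apply: ler_pM => //.
apply: le_trans (ler_normB _ _) _; rewrite normrM; apply: lerD.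
  exact: ler_pM.
by apply: le_trans N2B _; exact: ler_wpM2l.
Qed.

End two_curves.

(** The flow field is Lipschitz on bounded sets of curves whose lengths stay away
    from 0. The kernel is only Lipschitz, but this suffices because the velocity
    involves the kernel and not its derivative. *)
Lemma flow_lipschitz (lambda b m M : R) : 0 < m -> exists C : R,
  forall gamma1 gamma2 F1 F2,
    m <= curve_length gamma1 <= M -> m <= curve_length gamma2 <= M ->
    (forall i, `|gamma2 0 0 i| <= M) ->
    (forall u, 0 <= u <= 1 -> F1 u = flow_field lambda b gamma1 u) ->
    (forall u, 0 <= u <= 1 -> F2 u = flow_field lambda b gamma2 u) ->
    base_norm (F1 - F2) <= C * base_norm (gamma1 - gamma2).
Proof.
move=> m0.
have [l l0 Gl] := circle_kernel_lipschitz lambda.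
have [B B0 GB] := circle_kernel_bounded lambda.
have [K [dK K0 Kper]] := circle_kernel_antiderivative lambda.
have [la [A [la0 A0 laP AP]]] := flow_coef_lipschitz lambda b M m0.
pose k := 1 + `|K 1|.
pose CN := B + B * (4 / m) * M.
pose C0 := A * CN + la * (k * M + B * M).
pose CJ := B + l * (4 / m) * M.
pose J := 2 * B * M.
pose C1 := A + A * J / m + (la * J / m + (la + A * J / m / m +
  A * (2 * CJ) / m)) * M.
have im : 0 <= m^-1 by rewrite invr_ge0 ltW.
exists (2 * (A * k + C0) + C1) => gamma1 gamma2 F1 F2 L1I L2I g2M FE1 FE2.
have M0 : 0 <= M.
  by case/andP: L1I => mL LM; exact: le_trans (ltW m0) (le_trans mL LM).
have k0 : 0 <= k by rewrite addr_ge0.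
have C00 : 0 <= C0 by rewrite !addr_ge0 ?mulr_ge0// addr_ge0 ?mulr_ge0.
have CJ0 : 0 <= CJ by rewrite addr_ge0 ?mulr_ge0.
have J0 : 0 <= J by rewrite !mulr_ge0.
have C10 : 0 <= C1 by rewrite !addr_ge0 ?mulr_ge0// !addr_ge0 ?mulr_ge0.
pose n := base_norm (gamma1 - gamma2).
have base i : `|W11_fun (F1 - F2) 0 0 i| <= (A * k + C0) * n.
  have := coord0_flow_dist_le Gl B0 GB dK K0 Kper la0 laP AP m0
    erefl erefl erefl L1I L2I FE1 FE2 (g2M i).
  have := coord0_le_base_norm (gamma1 - gamma2) i.
  have := curve_length_le_base_norm (gamma1 - gamma2).
  rewrite -/n -/k -/CN.
  move: n (curve_length _) (`|W11_fun (gamma1 - gamma2) 0 0 i|).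
  move: `|W11_fun (F1 - F2) 0 0 i| => y n' D x Dn xn; move/le_trans; apply.
  have -> : A * k * x + A * (CN * D) + la * D * (k * M + B * M) =
      A * k * x + C0 * D by rewrite /C0; ring.
  rewrite [leRHS]mulrDl; apply: lerD; apply: ler_wpM2l => //; exact: mulr_ge0.
have len : curve_length (F1 - F2) <= C1 * n.
  have := curve_length_flow_dist_le l0 Gl B0 GB dK Kper la0 laP AP m0
    erefl erefl erefl L1I L2I FE1 FE2.
  have := curve_length_le_base_norm (gamma1 - gamma2).
  have := curve_length_ge0 (gamma1 - gamma2).
  move: L1I L2I => /andP[_ LM1] /andP[_ LM2].
  rewrite -/n -/J -/CJ; move: LM1 LM2.
  move: (n) (curve_length (gamma1 - gamma2)) (curve_length (F1 - F2)).
  move: (curve_length gamma1) (curve_length gamma2).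
  move=> L1 L2 n' D y LM1 LM2 D0 Dn; move/le_trans; apply.
  have h1 : la * D * J / m * L1 <= la * D * J / m * M.
    by apply: ler_wpM2l => //; rewrite !mulr_ge0.
  have h2 : (la * D + A * J * D / m / m + A * (2 * (CJ * D)) / m) * L2 <=
            (la * D + A * J * D / m / m + A * (2 * (CJ * D)) / m) * M.
    by apply: ler_wpM2l => //; rewrite !addr_ge0 ?mulr_ge0.
  apply: le_trans (lerD (lerD (lexx _) h1) h2) _.
  apply: (@le_trans _ _ (C1 * D)); last exact: ler_wpM2l.
  by rewrite le_eqVlt; apply/predU1P; left; rewrite /C1; ring.
have -> : (2 * (A * k + C0) + C1) * n =
    (A * k + C0) * n + (A * k + C0) * n + C1 * n by ring.
exact: lerD (lerD (base 0) (base 1)) len.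
Qed.

End flow_lipschitz.

(** * Differential inequalities for seminorms *)

Section seminorm_gronwall.
Context {R : realType} {V : normedModType R}.

Definition diff_on (I : set R) (f df : R -> V) := forall t, I t ->
  (s - t)^-1 *: (f s - f t) @[s --> within I t^'] --> df t.

Lemma diff_onS (I J : set R) (f df : R -> V) :
  J `<=` I -> diff_on I f df -> diff_on J f df.
Proof.
move=> JI fI t Jt; apply: cvg_trans (fI t (JI _ Jt)); apply: cvg_app => P.
have dF : Filter t^' by exact: dnbhs_filter.
rewrite /within /=; apply: (@filterS _ t^') => s h Js; exact/h/JI.
Qed.

Lemma diff_onB (I : set R) (f df g dg : R -> V) :
  diff_on I f df -> diff_on I g dg ->
  diff_on I (fun t => f t - g t) (fun t => df t - dg t).
Proof.
move=> fI gI t It; rewrite [X in X @ _](_ : _ = (fun s =>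
    (s - t)^-1 *: (f s - f t) - (s - t)^-1 *: (g s - g t))).
  by apply: cvgB; [exact: fI|exact: gI].
by apply/funext => s; rewrite -scalerBr !opprD addrACA.
Qed.

Lemma diff_on_taylor (I : set R) (f df : R -> V) t e : diff_on I f df -> I t ->
  0 < e -> \forall s \near within I (nbhs t),
    `|f s - f t - (s - t) *: df t| <= e * `|s - t|.
Proof.
move=> fI It e0; have /cvgrPdist_le/(_ _ e0) := fI t It.
move=> h; rewrite near_withinE; apply: (@filterS _ (nbhs t)) h => s fs Is.
have [->|st] := eqVneq s t; first by rewrite !subrr scale0r subr0 !normr0 mulr0.
have st0 : s - t != 0 by rewrite subr_eq0.
have := fs st Is; rewrite -(ler_pM2r (_ : 0 < `|s - t|)) ?normr_gt0//.
apply: le_trans; rewrite mulrC -normrZ scalerBr scalerA mulfV// scale1r.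
by rewrite distrC.
Qed.

Variables (N : V -> R) (c : R).
Hypotheses (c0 : 0 <= c) (ND : forall v w, N (v + w) <= N v + N w)
  (NZ : forall a v, N (a *: v) = `|a| * N v) (Nc : forall v, N v <= c * `|v|).

Let NB v w : `|N v - N w| <= N (v - w).
Proof.
have le1 x y : N x - N y <= N (x - y).
  by rewrite lerBlDr -{1}(subrK y x) ND.
rewrite ler_norml le1 andbT lerNl opprB; apply: le_trans (le1 w v) _.
by rewrite -(opprB v w) -scaleN1r NZ normrN1 mul1r.
Qed.

Lemma diff_on_seminorm_continuous (I : set R) (f df : R -> V) :
  diff_on I f df -> {within I, continuous (N \o f)}.
Proof.
move=> fI; apply: within_continuousI => t It; apply/cvgrPdist_le => e e0.
pose k := c * (`|df t| + 1) + 1.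
have k0 : 0 < k by rewrite ltr_wpDl// mulr_ge0// addr_ge0.
have tay := diff_on_taylor fI It ltr01.
have small : \forall s \near within I (nbhs t), `|s - t| <= e / k.
  rewrite near_withinE; have /cvgrPdist_le := @cvg_id _ (nbhs t).
  by move=> /(_ _ (divr_gt0 e0 k0)); apply: filterS => s; rewrite distrC.
near=> s.
have st : `|s - t| <= e / k by near: s.
have ft : `|f s - f t - (s - t) *: df t| <= 1 * `|s - t| by near: s.
rewrite distrC; apply: le_trans (NB _ _) _; apply: le_trans (Nc _) _.
have : `|f s - f t| <= `|s - t| * (`|df t| + 1).
  rewrite -(subrK ((s - t) *: df t) (f s - f t)).
  apply: le_trans (ler_normD _ _) _; rewrite normrZ mulrDr mulr1 addrC lerD2l.
  by rewrite -[leRHS]mul1r.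
move=> /(ler_wpM2l c0)/le_trans; apply.
rewrite mulrCA; move: st; rewrite ler_pdivlMr//; apply: le_trans.
by apply: ler_wpM2l => //; rewrite lerDl.
Unshelve. all: by end_near. Qed.

(** Both bounds follow from |N (f s) - N (f t)| <= N (f s - f t), which limits
    the decrease of N (f t) as well as its increase. *)
Lemma seminorm_gronwall (f df : R -> V) (K T : R) : 0 <= T ->
  diff_on `[0, T] f df ->
  (forall t, 0 <= t < T -> N (df t) <= K * N (f t)) ->
  N (f T) <= expR (K * T) * N (f 0) /\ N (f 0) <= expR (K * T) * N (f T).
Proof.
move=> T0 fI dfK; have cN := diff_on_seminorm_continuous fI.
have slope t : 0 <= t < T -> forall e, 0 < e ->
    \forall s \near t^'+, `|N (f s) - N (f t)| <= (s - t) * (K * N (f t) + e).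
  move=> tI e e0; have /andP[t0 tT] := tI.
  have It : `[0, T]%classic t by rewrite /= in_itv/= t0 ltW.
  have c1 : 0 < c + 1 by rewrite ltr_wpDl.
  have tay := diff_on_taylor fI It (divr_gt0 e0 c1).
  have {}tay : \forall s \near t^'+, `|f s - f t - (s - t) *: df t| <=
      e / (c + 1) * `|s - t|.
    move: tay; rewrite near_withinE => h.
    have h2 : \forall s \near t^'+, t < s by exact: nbhs_right_gt.
    have h3 : \forall s \near t^'+, s <= T by exact: nbhs_right_le.
    have h1 : \forall s \near t^'+, `[0, T]%classic s ->
        `|f s - f t - (s - t) *: df t| <= e / (c + 1) * `|s - t|.
      exact: cvg_within h.
    move: h1 h2 h3; apply: filterS3 => s fs ts sT.
    by apply: fs; rewrite /= in_itv/= sT (le_trans t0) ?ltW.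
  near=> s; have ts : t < s by near: s; exact: nbhs_right_gt.
  have st0 : 0 <= s - t by rewrite subr_ge0 ltW.
  apply: le_trans (NB _ _) _.
  rewrite -(subrK ((s - t) *: df t) (f s - f t)).
  apply: le_trans (ND _ _) _; rewrite NZ ger0_norm// mulrDr addrC.
  apply: lerD; first by apply: ler_wpM2l => //; exact: dfK.
  apply: le_trans (Nc _) _.
  have : `|f s - f t - (s - t) *: df t| <= e / (c + 1) * `|s - t| by near: s.
  rewrite (ger0_norm st0) => /(ler_wpM2l c0)/le_trans; apply.
  rewrite [leRHS]mulrC mulrA; apply: ler_wpM2r => //.
  rewrite mulrA ler_pdivrMr// [c * e]mulrC.
  by apply: ler_wpM2l; [exact: ltW|rewrite lerDl].
split.
  apply: (@dini_gronwall _ (N \o f)) => // t tI e e0.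
  by apply: filterS (slope t tI e e0) => s; apply: le_trans; exact: ler_norm.
have : - N (f T) <= expR (- K * T) * - N (f 0).
  apply: (@dini_gronwall _ (fun t => - N (f t))) => //.
    by apply: within_continuousI => t It; apply: cvgN; exact: within_cvg cN It.
  move=> t tI e e0; apply: filterS (slope t tI e e0) => s.
  rewrite mulrNN; apply: le_trans.
  by rewrite -normrN opprB opprK addrC ler_norm.
rewrite mulrN lerN2 mulNr expRN => h.
by rewrite -ler_pdivrMl ?expR_gt0.
Unshelve. all: by end_near. Qed.

End seminorm_gronwall.

(** * Positivity of the length and uniqueness of solutions *)

Section flow_dynamics.
Context {R : realType}.
Notation mu := (@lebesgue_measure R).
Implicit Types (X Z : R -> W11 R) (S T : \bar R).

Lemma vanishing_curve_length (F : W11 R) :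
  (forall u, 0 <= u <= 1 -> F u = 0) -> curve_length F = 0.
Proof.
move=> F0.
have w0 : is_wderiv F (fun=> 0).
  move=> i; split.
    rewrite (_ : _ \o _ = cst 0%E); first exact: integrable0.
    by apply/funext => u /=; rewrite mxE.
  move=> phi _; rewrite (_ : \int[mu]_(u in _) (F u 0 i * _) =
      \int[mu]_(u in `[0, 1]) (0 : R)).
    rewrite [X in - X](_ : _ = \int[mu]_(u in `[0, 1]) (0 : R)).
      by rewrite Rintegral_cst_itv// mul0r oppr0.
    by apply: eq_Rintegral => u _; rewrite mxE mul0r.
  apply: eq_Rintegral => u /set_mem/=; rewrite in_itv/= => /F0 ->.
  by rewrite mxE mul0r.
rewrite (ae_curve_length (g := fun=> 0) (wderiv_unique (wderivP F) w0)).
  under eq_Rintegral do rewrite -(scale0r 0) enormZ normr0 mul0r.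
  by rewrite Rintegral_cst_itv// mul0r.
by move=> i; exact: measurable_cst.
Qed.

(** For the exponent 2 the flow field is homogeneous of degree 1, so its length
    is controlled by that of the curve with a constant that does not degenerate
    as the length tends to 0. *)
Lemma curve_length_flow2_le (lambda : R) : exists K : R,
  forall gamma F : W11 R,
    (forall u, 0 <= u <= 1 -> F u = flow_field lambda 2 gamma u) ->
    curve_length F <= K * curve_length gamma.
Proof.
have [l l0 Gl] := circle_kernel_lipschitz lambda.
have [B B0 GB] := circle_kernel_bounded lambda.
have [K [dK _ Kper]] := circle_kernel_antiderivative lambda.
exists (1 / lambda ^+ 2 * (1 + 2 * B)) => gamma F FE.
have := curve_length_ge0 gamma; rewrite le_eqVlt => /predU1P[L0|L0].
  rewrite -L0 mulr0 vanishing_curve_length// => u /FE ->.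
  by rewrite /flow_field -L0 eqxx.
have := curve_length_flow_le l0 Gl B0 GB dK Kper L0 FE.
by rewrite subrr powRr0.
Qed.

Lemma sub_time_itv (T : \bar R) (t : R) : 0 <= t -> (t%:E < T)%E ->
  `[0, t]%classic `<=` time_itv T.
Proof.
move=> t0 tT s /=; rewrite in_itv/= => /andP[s0 st]; split=> //.
by apply: le_lt_trans tT; rewrite lee_fin.
Qed.

Lemma curve_length_norm_le (f : W11 R) : curve_length f <= 1 * `|f|.
Proof. by rewrite mul1r; exact: curve_length_le_norm. Qed.

(** The length decreases at most exponentially, hence never reaches 0. *)
Lemma flow2_positive_length (lambda : R) (Y : R -> W11 R) :
  flow_solution lambda 2 +oo%E Y -> 0 < curve_length (Y 0) ->
  positive_length +oo%E Y.
Proof.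
move=> [dY [diffY _] YE] L0 t It; have [t0 _] := It.
have [K KP] := curve_length_flow2_le lambda.
have sub := sub_time_itv t0 (ltry t).
have dK s : 0 <= s < t -> curve_length (dY s) <= K * curve_length (Y s).
  move=> /andP[s0 st]; apply: KP => u; apply: YE.
  by split=> //; exact: ltry.
have [_] := seminorm_gronwall ler01 ler_curve_lengthD curve_lengthZ
  curve_length_norm_le t0 (diff_onS sub diffY) dK.
by move=> /(lt_le_trans L0); rewrite pmulr_rgt0// expR_gt0.
Qed.

(** On a compact time interval the two curves stay bounded, with lengths bounded
    away from 0, so that the flow field is Lipschitz on the curves that
    occur. *)
Lemma flow_unique (lambda b : R) S T X Z :
  flow_solution lambda b S X -> positive_length S X ->
  flow_solution lambda b T Z -> positive_length T Z -> X 0 = Z 0 ->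
  forall t, time_itv S t -> time_itv T t -> X t = Z t.
Proof.
move=> [dX [diffX _] XE] Xpos [dZ [diffZ _] ZE] Zpos XZ0 t [t0 tS] [_ tT].
have subS := sub_time_itv t0 tS; have subT := sub_time_itv t0 tT.
have {}diffX := diff_onS subS diffX; have {}diffZ := diff_onS subT diffZ.
have base3 : 0 <= (3 : R) by [].
have cLX := diff_on_seminorm_continuous ler01 ler_curve_lengthD curve_lengthZ
  curve_length_norm_le diffX.
have cLZ := diff_on_seminorm_continuous ler01 ler_curve_lengthD curve_lengthZ
  curve_length_norm_le diffZ.
have cBX := diff_on_seminorm_continuous base3 ler_base_normD base_normZ
  base_norm_le_norm diffX.
have cBZ := diff_on_seminorm_continuous base3 ler_base_normD base_normZ
  base_norm_le_norm diffZ.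
have [MX _ XM] := within_continuous_bounded cBX.
have [MZ _ ZM] := within_continuous_bounded cBZ.
have [m [m0 Xm Zm]] : exists m, [/\ 0 < m,
    forall s, s \in `[0, t]%R -> m <= curve_length (X s) &
    forall s, s \in `[0, t]%R -> m <= curve_length (Z s)].
  have [cx cxI Xm] := EVT_min t0 cLX; have [cz czI Zm] := EVT_min t0 cLZ.
  exists (Num.min (curve_length (X cx)) (curve_length (Z cz))); split.
  - rewrite lt_min; apply/andP; split; [exact: Xpos (subS _ cxI)|].
    exact: Zpos (subT _ czI).
  - by move=> s sI; rewrite ge_min; apply/orP; left; exact: Xm.
  - by move=> s sI; rewrite ge_min; apply/orP; right; exact: Zm.
pose M := Num.max MX MZ.
have [C CP] := flow_lipschitz lambda b M m0.
have bound s : 0 <= s <= t -> [/\ m <= curve_length (X s) <= M,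
    m <= curve_length (Z s) <= M & forall i, `|Z s 0 0 i| <= M].
  move=> sI; have sI' : s \in `[0, t]%R by rewrite in_itv.
  have XM' := le_trans (ler_norm _) (XM s sI).
  have ZM' := le_trans (ler_norm _) (ZM s sI).
  split.
  - apply/andP; split; first exact: Xm.
    rewrite le_max; apply/orP; left.
    exact: le_trans (curve_length_le_base_norm _) XM'.
  - apply/andP; split; first exact: Zm.
    rewrite le_max; apply/orP; right.
    exact: le_trans (curve_length_le_base_norm _) ZM'.
  - move=> i; rewrite le_max; apply/orP; right.
    exact: le_trans (coord0_le_base_norm _ i) ZM'.
have dXZ s : 0 <= s < t ->
    base_norm (dX s - dZ s) <= C * base_norm (X s - Z s).
  move=> /andP[s0 st]; have sI : 0 <= s <= t by rewrite s0 ltW.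
  have Is : `[0, t]%classic s by rewrite /= in_itv/=.
  have [bX bZ bZ0] := bound s sI.
  exact: CP bX bZ bZ0 (XE s (subS _ Is)) (ZE s (subT _ Is)).
have [+ _] := seminorm_gronwall base3 ler_base_normD base_normZ
  base_norm_le_norm t0 (diff_onB diffX diffZ) dXZ.
rewrite XZ0 subrr -(scale0r (0 : W11 R)) base_normZ normr0 mul0r mulr0 => n0.
apply/eqP; rewrite -subr_eq0; apply/eqP/base_norm0_eq0/le_anti.
by rewrite n0 base_norm_ge0.
Qed.

End flow_dynamics.

(** * Time reparametrisation *)

Section time_change.
Context {R : realType} {V : normedModType R}.

Lemma positive_derivative_increasing (clock w : R -> R) :
  (forall x : R, is_derive x 1 clock (w x)) -> (forall x, 0 < w x) ->
  {mono clock : x y / x < y}.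
Proof.
move=> dclock w0; have incr x y : x < y -> clock x < clock y.
  move=> xy.
  have cclock := continuous_subspaceT (is_derive_continuous dclock).
  have [c _ e] := MVT xy (fun z _ => dclock z) (cclock `[x, y]%classic).
  by rewrite -subr_gt0 e mulr_gt0// subr_gt0.
move=> x y; have [xy|yx] := ltP x y; first by rewrite incr.
move: yx; rewrite le_eqVlt => /predU1P[->|yx]; first by rewrite ltxx.
by apply/negbTE; rewrite -leNgt ltW// incr.
Qed.

Lemma inverse_cvg_within (I J : set R) (clock w tau : R -> R) (s : R) :
  (forall x : R, is_derive x 1 clock (w x)) -> (forall x, 0 < w x) ->
  (forall s, J s -> I (tau s) /\ clock (tau s) = s) -> J s ->
  tau r @[r --> within J (nbhs s)] --> within I (nbhs (tau s)).
Proof.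
move=> dclock w0 tauP Js P [e /= e0 eP].
have Tmono := positive_derivative_increasing dclock w0.
have [_ ts] := tauP s Js.
have lo : clock (tau s - e) < s by rewrite -[ltRHS]ts Tmono ltrBlDr ltrDl.
have hi : s < clock (tau s + e) by rewrite -[ltLHS]ts Tmono ltrDl.
have nlo : \forall r \near s, clock (tau s - e) < r by exact: lt_nbhsr.
have nhi : \forall r \near s, r < clock (tau s + e) by exact: lt_nbhsl.
move: nlo nhi; apply: (@filterS2 _ (nbhs s)) => r rlo rhi Jr.
have [Ir tr] := tauP r Jr; apply: (eP (tau r)) Ir => /=.
move: rlo rhi; rewrite -{1 2}tr !Tmono => h1 h2.
rewrite ltr_norml; lra.
Qed.

(** Write x = tau r and t = tau s. The difference quotient of f \o tau is that
    of f at x and t divided by that of clock, and x tends to t when r tends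
    to s. *)
Lemma C1_on_time_change (I J : set R) (clock w tau : R -> R)
    (f df : R -> V) :
  (forall x : R, is_derive x 1 clock (w x)) -> continuous w ->
  (forall x, 0 < w x) ->
  (forall s, J s -> I (tau s) /\ clock (tau s) = s) ->
  C1_on I f df ->
  C1_on J (f \o tau) (fun s => (w (tau s))^-1 *: df (tau s)).
Proof.
move=> dclock cw w0 tauP [dff cdf].
have ctau := fun s Js => inverse_cvg_within dclock w0 tauP (s := s) Js.
split; last first.
  apply: within_continuousI => s Js; apply: cvgZ.
    apply: cvgV; first by rewrite gt_eqF.
    apply: (@cvg_comp _ _ _ tau w _ (nbhs (tau s))); last exact: cw.
    by apply: cvg_trans (ctau s Js) _; exact: cvg_within.
  exact: (cvg_comp _ _ (ctau s Js) (within_cvg cdf (tauP s Js).1)).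
move=> s Js; have [It ts] := tauP s Js; set t := tau s in It ts *.
have ctau' : tau r @[r --> within J s^'] --> within I t^'.
  move=> P Pt; have Q : within I (nbhs t) (fun x => x != t -> P x).
    by apply: (@filterS _ (nbhs t)) Pt => x h Ix xt; exact: h.
  have := ctau s Js _ Q; apply: (@filterS _ (nbhs s)) => r h rs Jr.
  by apply: h => //; apply: contra_neq rs => e; rewrite -(tauP r Jr).2 e.
have slope : ((x - t)^-1 * (clock x - clock t))^-1 *:
    ((x - t)^-1 *: (f x - f t)) @[x --> within I t^'] --> (w t)^-1 *: df t.
  apply: cvgZ; last exact: dff.
  apply: cvgV; first by rewrite gt_eqF.
  by apply: cvg_within_filter; exact: is_derive_slope.
have := cvg_comp _ _ ctau' slope; apply: cvg_trans; apply: near_eq_cvg.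
rewrite near_withinE; near=> r => Jr.
have rs : r != s by near: r; exact: nbhs_dnbhs_neq.
have [Ir tr] := tauP r Jr.
have rt : tau r - t != 0.
  by rewrite subr_eq0; apply: contra_neq rs => e; rewrite -tr e.
rewrite /= tr ts scalerA invfM invrK; congr (_ *: _).
by rewrite mulrAC mulfV// mul1r.
Unshelve. all: by end_near. Qed.

End time_change.

Section reparametrisation.
Context {R : realType}.

(** Freezing f before time 0 gives the new time a two-sided derivative at 0. *)
Lemma continuous_extend0 (f : R -> R) : {within time_itv +oo%E, continuous f} ->
  continuous (fun t : R => f (Num.max t 0)).
Proof.
move=> cf x; have Ix (y : R) : time_itv +oo%E (Num.max y 0 : R).
  by split; [rewrite le_max lexx orbT|exact: ltry].
have c : (fun y : R => Num.max y 0) y @[y --> x] --> (Num.max x 0 : R).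
  by apply: continuous_max; [exact: cvg_id|exact: cvg_cst].
have cmax : (fun y : R => Num.max y 0) y @[y --> x] -->
    within (time_itv +oo%E) (nbhs (Num.max x 0 : R)).
  move=> P Pt; have := c _ Pt.
  by apply: (@filterS _ (nbhs x)) => y h; exact: h (Ix y).
exact: (cvg_comp _ _ cmax (within_cvg cf (Ix x))).
Qed.

(** The powers of the length cancel: (2 - 2) - (2 - a) = a - 2. *)
Lemma flow_field_rescale (lambda a : R) (gamma : W11 R) u :
  0 < curve_length gamma ->
  (curve_length gamma `^ (2 - a))^-1 *: flow_field lambda 2 gamma u =
  flow_field lambda a gamma u.
Proof.
move=> L0; rewrite /flow_field gt_eqF// scalerA subrr powRr0 -powRN opprB.
by congr (_ *: _); rewrite mulrN mulrA mulr1.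
Qed.

End reparametrisation.

Theorem proposition5p9 (R : realType) (a lambda : R) (X0 : W11 R)
    (Ta : \bar R) (X Y : R -> W11 R) :
  0 < lambda -> 0 < curve_length X0 ->
  maximal_pl_solution lambda a Ta X -> X 0 = X0 ->
  flow_solution lambda 2 +oo%E Y -> Y 0 = X0 ->
  let theta (t : R) : R :=
    \int[lebesgue_measure]_(tau in `[0, t]) (curve_length (Y tau) `^ (2 - a)) in
  forall t : R, 0 <= t -> time_itv Ta (theta t) /\ Y t = X (theta t).
Proof.
move=> _ L0 [Ta0 solX posX maxX] X0E solY Y0E theta.
have posY : positive_length +oo%E Y.
  by apply: flow2_positive_length solY _; rewrite Y0E.
have [dY [diffY cdY] YE] := solY.
have diffY' : diff_on (time_itv +oo%E) Y dY := diffY.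
have cL := diff_on_seminorm_continuous ler01 ler_curve_lengthD curve_lengthZ
  curve_length_norm_le diffY'.
pose Lp (t : R) := curve_length (Y (Num.max t 0)).
have posLp t : 0 < Lp t.
  by apply: posY; split; [rewrite le_max lexx orbT|exact: ltry].
have cLp : continuous Lp := continuous_extend0 cL.
have LpE t : 0 <= t -> Lp t = curve_length (Y t).
  by move=> t0; rewrite /Lp max_l.
clearbody Lp.
pose w t := Lp t `^ (2 - a).
have w0 t : 0 < w t := powR_gt0 _ (posLp t).
have cw : continuous w.
  move=> t; apply: (@continuous_comp _ _ _ Lp (fun x => x `^ (2 - a))).
    exact: cLp.
  have dp := is_derive1_powR (2 - a) (posLp t).
  by apply/differentiable_continuous/derivable1_diffP; exact: ex_derive.
have [clock [clock0 dclock clockE]] := continuous_antiderivative cw.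
have Tmono := positive_derivative_increasing dclock w0.
have wE t : 0 <= t -> w t = curve_length (Y t) `^ (2 - a).
  by move=> t0; rewrite /w LpE.
have thetaE t : 0 <= t -> theta t = clock t.
  move=> t0; rewrite (clockE t t0); apply: eq_Rintegral => s /set_mem/=.
  by rewrite in_itv/= => /andP[s0 _]; rewrite wE.
(* The end of the range of the new time, in which clock is inverted by tau. *)
pose S := ereal_sup [set (clock t)%:E | t in [set t | 0 <= t]].
have clockS t : 0 <= t -> ((clock t)%:E < S)%E.
  move=> t0; apply: (@lt_le_trans _ _ (clock (t + 1))%:E).
    by rewrite lte_fin Tmono ltrDl.
  by apply: ereal_sup_ubound; exists (t + 1) => //=; rewrite addr_ge0.
have surj s : time_itv S s -> exists t, 0 <= t /\ clock t = s.
  move=> [s0 /ereal_sup_gt[_ /= [t1 t10 <-]]]; rewrite lte_fin => st1.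
  have [||t tI ts] := @IVT R clock 0 t1 s t10.
  - exact/continuous_subspaceT/(is_derive_continuous dclock).
  - by rewrite clock0 ge_min le_max s0 (ltW st1) orbT.
  - by exists t; split => //; move: tI; rewrite in_itv/= => /andP[].
pose tau s := xget 0 [set t | 0 <= t /\ clock t = s].
have tauP s : time_itv S s -> time_itv +oo%E (tau s) /\ clock (tau s) = s.
  by move=> /surj/(xgetPex 0)[h1 h2]; split => //; split => //; exact: ltry.
have clock_ge0 t : 0 <= t -> 0 <= clock t.
  by rewrite le_eqVlt => /predU1P[<-|t0]; rewrite ?clock0// -clock0 ltW// Tmono.
have tauK t : 0 <= t -> tau (clock t) = t.
  move=> t0; have [_ e] := tauP (clock t) (conj (clock_ge0 t t0) (clockS t t0)).
  have [|] := ltP (tau (clock t)) t; first by rewrite -Tmono e ltxx.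
  by rewrite le_eqVlt => /predU1P[//|]; rewrite -Tmono e ltxx.
pose Z := Y \o tau.
have posZ : positive_length S Z by move=> s /tauP[/posY].
have solZ : flow_solution lambda a S Z.
  exists (fun s => (w (tau s))^-1 *: dY (tau s)).
    exact: C1_on_time_change dclock cw w0 tauP (conj diffY cdY).
  move=> s Is u uI; have [Itau _] := tauP s Is.
  rewrite W11_scaleE (YE _ Itau _ uI) wE; last by case: Itau.
  by apply: flow_field_rescale; exact: posY.
have XZ0 : X 0 = Z 0 by rewrite X0E /Z /= -clock0 tauK.
have XZ := flow_unique solX posX solZ posZ XZ0.
(* Otherwise Z would extend X, against maximality. *)
have STa : (S <= Ta)%E.
  rewrite leNgt; apply/negP => TaS.
  have : (S <= Ta)%E.
    apply: maxX solZ posZ _ => t It; apply/esym/XZ => //.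
    by case: It => t0 tTa; split => //; exact: lt_trans TaS.
  by rewrite leNgt TaS.
move=> t t0; rewrite thetaE//.
have IS : time_itv S (clock t) by split; [exact: clock_ge0|exact: clockS].
have ITa : time_itv Ta (clock t).
  split; [exact: clock_ge0|exact: lt_le_trans (clockS t t0) STa].
by split=> //; rewrite XZ// /Z /= tauK.
Qed.
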